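(* For every non-hyperoctahedral category $\mathcal{C}\subseteq \mathcal{P}^{\circ\bullet}$ of two-colored partitions, $Z(\mathcal{C})\in\mathsf{Q}$.
   Context: **Two-colored partitions.** $\mathbb{N}=\{1,2,3,\ldots\}$. A two-colored partition $p$ consists of finitely many (possibly zero) upper points and finitely many (possibly zero) lower points, each row ordered from left to right, a color $\circ$ (white) or $\bullet$ (black) for every point, and a decomposition of the set $P_p$ of all points into disjoint non-empty subsets, called blocks. $\mathcal{P}^{\circ\bullet}$ is the set of all two-colored partitions. The tensor product $p\otimes q$ places $q$ to the right of $p$. The involution $p\mapsto p^\ast$ exchanges upper and lower row, keeping colors and the left-right order. If the upper row of $p$ and the lower row of $q$ agree in length and coloring, the pair $(p,q)$ is composable and the composition $pq$ is obtained by putting $p$ below $q$, identifying the upper row of $p$ with the lower row of $q$, joining blocks which meet there, and deleting the identified points (and any blocks which have become empty). **Categories.** A category of two-colored partitions is a set $\mathcal{C}\subseteq\mathcal{P}^{\circ\bullet}$ closed under tensor products, involution and composition of composable pairs, which contains, for each color, the partition with one upper and one lower point of that color forming one block, and which contains the two partitions with no upper points and two lower points colored $\circ\bullet$, respectively $\bullet\circ$, forming one block. Let $s$ be the partition with no upper points and two lower points colored $\circ\bullet$, each a singleton block; let $f$ be the partition with no upper points and four lower points colored $\circ\bullet\circ\bullet$ forming one block. A category $\mathcal{C}$ is non-hyperoctahedral if $s\in\mathcal{C}$ or $f\notin\mathcal{C}$. **Orientation and colors.** The points of $p$ carry the cyclic order which runs through the lower row from left to right, then through the upper row from right to left, and then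 returns to the leftmost lower point. A tuple of pairwise distinct points is ordered if its entries are met in that order when starting at the first entry and running once through the cyclic order. For points $\alpha\ne\beta$, $]\alpha,\beta[_p$ is the set of points strictly between $\alpha$ and $\beta$ when running from $\alpha$ to $\beta$, and $]\alpha,\beta]_p=\,]\alpha,\beta[_p\cup\{\beta\}$. The normalized color of a lower point is its color; that of an upper point is the opposite color. For a set $S$ of points, the color sum $\sigma_p(S)$ is the number of points in $S$ of normalized color $\circ$ minus the number of those of normalized color $\bullet$. The total color sum is $\Sigma(p)=\sigma_p(P_p)$. The color distance of points $\alpha\neq\beta$ is $$\delta_p(\alpha,\beta)=\sigma_p(]\alpha,\beta]_p)+\tfrac12\big(\sigma_p(\{\alpha\})-\sigma_p(\{\beta\})\big),$$ i.e. $\sigma_p(]\alpha,\beta]_p)$ if the normalized colors agree and $\sigma_p(]\alpha,\beta[_p)$ if they differ. Two distinct blocks $B_1,B_2$ cross if there are $\alpha_1,\beta_1\in B_1$ and $\alpha_2,\beta_2\in B_2$, pairwise distinct, such that $(\alpha_1,\alpha_2,\beta_1,\beta_2)$ is ordered. **The analyzer $Z$.** For $\mathcal{S}\subseteq\mathcal{P}^{\circ\bullet}$ let $Z(\mathcal{S})=(F,V,\Sigma,L,K,X)(\mathcal{S})$, a sextuple of subsets of $\mathbb{Z}$, where - $F(\mathcal{S})=\{|B| : p\in\mathcal{S},\ B \text{ block of } p\}$, - $V(\mathcal{S})=\{\sigma_p(B): p\in\mathcal{S},\ B\text{ block of }p\}$, - $\Sigma(\mathcal{S})=\{\Sigma(p):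 p\in\mathcal{S}\}$, - $L(\mathcal{S})=\{\delta_p(\alpha_1,\alpha_2): p\in\mathcal{S},\ B\text{ block of }p,\ \alpha_1,\alpha_2\in B,\ \alpha_1\ne\alpha_2,\ ]\alpha_1,\alpha_2[_p\cap B=\emptyset,\ \sigma_p(\{\alpha_1,\alpha_2\})\neq 0\}$, - $K(\mathcal{S})=\{\delta_p(\alpha_1,\alpha_2): p\in\mathcal{S},\ B\text{ block of }p,\ \alpha_1,\alpha_2\in B,\ \alpha_1\ne\alpha_2,\ ]\alpha_1,\alpha_2[_p\cap B=\emptyset,\ \sigma_p(\{\alpha_1,\alpha_2\})= 0\}$, - $X(\mathcal{S})=\{\delta_p(\alpha_1,\alpha_2): p\in\mathcal{S},\ B_1,B_2\text{ crossing blocks of }p,\ \alpha_1\in B_1,\ \alpha_2\in B_2\}$. **Notation for sets of integers.** $xA+yB=\{xa+yb: a\in A,b\in B\}$, $x+yB=\{x+yb:b\in B\}$, $\pm S=S\cup(-S)$; for $m\in\mathbb{Z}$ and $D\subseteq\mathbb{Z}$: $D_m=(D\cup(m-D))+m\mathbb{Z}$ and $D_m'=(D\cup(m-D)\cup\{0\})+m\mathbb{Z}$ (in particular $D_0=D\cup(-D)$, $D_0'=D\cup(-D)\cup\{0\}$). $[\![0]\!]=\emptyset$ and $[\![k]\!]=\{1,\ldots,k\}$ for $k\in\mathbb{N}$. **The parameter range $\mathsf{Q}$.** $\mathsf{Q}$ is the set of all sextuples $(f,v,s,l,k,x)$ of subsets of $\mathbb{Z}$ of one of the following forms, where $u\in\{0\}\cup\mathbb{N}$,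 $m\in\mathbb{N}$, $D\subseteq\{0\}\cup[\![\lfloor\frac m2\rfloor]\!]$, $E\subseteq\{0\}\cup\mathbb{N}$, and $N$ is a subsemigroup of $(\mathbb{N},+)$ (the empty set allowed): 1. $(\{2\},\ \pm\{0,2\},\ 2um\mathbb{Z},\ m\mathbb{Z},\ m\mathbb{Z},\ \mathbb{Z})$ 2. $(\{2\},\ \pm\{0,2\},\ 2um\mathbb{Z},\ m+2m\mathbb{Z},\ 2m\mathbb{Z},\ \mathbb{Z})$ 3. $(\{2\},\ \pm\{0,2\},\ 2um\mathbb{Z},\ m+2m\mathbb{Z},\ 2m\mathbb{Z},\ \mathbb{Z}\setminus m\mathbb{Z})$ 4. $(\{2\},\ \{0\},\ \{0\},\ \emptyset,\ m\mathbb{Z},\ \mathbb{Z})$ 5. $(\{2\},\ \pm\{0,2\},\ \{0\},\ \{0\},\ \{0\},\ \mathbb{Z}\setminus N_0)$ 6. $(\{2\},\ \{0\},\ \{0\},\ \emptyset,\ \{0\},\ \mathbb{Z}\setminus N_0)$ 7. $(\{2\},\ \{0\},\ \{0\},\ \emptyset,\ \{0\},\ \mathbb{Z}\setminus N_0')$ 8. $(\{1,2\},\ \pm\{0,1,2\},\ um\mathbb{Z},\ m\mathbb{Z},\ m\mathbb{Z},\ \mathbb{Z}\setminus D_m)$ 9. $(\{1,2\},\ \pm\{0,1,2\},\ 2um\mathbb{Z},\ m+2m\mathbb{Z},\ 2m\mathbb{Z},\ \mathbb{Z}\setminus D_m)$ 10. $(\{1,2\},\ \pm\{0,1\},\ um\mathbb{Z},\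 \emptyset,\ m\mathbb{Z},\ \mathbb{Z}\setminus D_m)$ 11. $(\{1,2\},\ \pm\{0,1,2\},\ \{0\},\ \{0\},\ \{0\},\ \mathbb{Z}\setminus E_0)$ 12. $(\{1,2\},\ \pm\{0,1\},\ \{0\},\ \emptyset,\ \{0\},\ \mathbb{Z}\setminus E_0)$ 13. $(\mathbb{N},\ \mathbb{Z},\ um\mathbb{Z},\ m\mathbb{Z},\ m\mathbb{Z},\ \mathbb{Z}\setminus D_m)$ 14. $(\mathbb{N},\ \mathbb{Z},\ \{0\},\ \{0\},\ \{0\},\ \mathbb{Z}\setminus E_0)$ *)

(* Defs.v *)
From HB Require Import structures.
From mathcomp Require Import all_boot all_order all_algebra.

Set Implicit Arguments.
Unset Strict Implicit.
Unset Printing Implicit Defensive.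

Import Order.TTheory GRing.Theory Num.Theory.

Local Open Scope nat_scope.
Local Open Scope set_scope.

Variant color := White | Black.

Definition opp_color (c : color) : color :=
  if c is White then Black else White.

Definition color_sign (c : color) : int :=
  (if c is White then 1 else - 1)%R.

(* Points of a partition with upper row [u] and lower row [l], both read from
   left to right: [inl i] is the i-th upper, [inr j] the j-th lower point. *)
Definition points (u l : seq color) : finType :=
  ('I_(size u) + 'I_(size l))%type.

Record tcpart := TCPart {
  upper : seq color;
  lower : seq color;
  blocks : {set {set points upper lower}};
  blocksP : partition blocks [set: points upper lower]
}.

Notation pt p := (points (upper p) (lower p)).

Definition same_block (p : tcpart) : rel (pt p) :=
  fun x y => y \in pblock (blocks p) x.

Definition one_block (u l : seq color) : tcpart :=
  TCPart (preim_partitionP (fun _ : points u l => tt) [set: points u l]).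

Definition singletons (u l : seq color) : tcpart :=
  TCPart (preim_partitionP (fun x : points u l => x) [set: points u l]).

Section Involution.
Variable p : tcpart.

Definition flip (x : pt p) : points (lower p) (upper p) :=
  match x with inl i => inr i | inr j => inl j end.

Lemma flip_inj : injective flip.
Proof. by case=> [i|i] [j|j] //= [->]. Qed.

Lemma involution_subproof :
  partition [set flip @: B | B : {set _} in blocks p]
                   [set: points (lower p) (upper p)].
Proof.
have -> : [set: points (lower p) (upper p)] = flip @: [set: pt p].
  apply/setP=> x; rewrite !inE; apply/esym/imsetP.
  by case: x => [i|i]; [exists (inr i)|exists (inl i)]; rewrite ?inE.
by rewrite imset_partition ?blocksP //; exact: flip_inj.
Qed.

Definition involution : tcpart := TCPart involution_subproof.

End Involution.

Section Tensor.
Variables p q : tcpart.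

Let pqpt := points (upper p ++ upper q) (lower p ++ lower q).

Definition tensl (x : pt p) : pqpt :=
  match x with
  | inl i => inl (cast_ord (esym (size_cat _ _)) (lshift _ i))
  | inr j => inr (cast_ord (esym (size_cat _ _)) (lshift _ j))
  end.

Definition tensr (x : pt q) : pqpt :=
  match x with
  | inl i => inl (cast_ord (esym (size_cat _ _)) (rshift _ i))
  | inr j => inr (cast_ord (esym (size_cat _ _)) (rshift _ j))
  end.

Lemma tensl_inj : injective tensl.
Proof.
by case=> [i|i] [j|j] //= [] /eqP; rewrite ?eqn_add2l => /eqP /ord_inj ->.
Qed.

Lemma tensr_inj : injective tensr.
Proof.
case=> [i|i] [j|j] //= [] /eqP; rewrite ?eqn_add2l => /eqP h;
  by congr (_ _); apply: ord_inj.
Qed.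

Lemma tenslr_neq x y : tensl x != tensr y.
Proof.
apply/eqP; case: x y => [i|i] [j|j] //= [] h;
  by have := ltn_ord i; rewrite h -ltn_subRL subnn.
Qed.

Lemma tens_cover x : (x \in codom tensl) || (x \in codom tensr).
Proof.
case: x => i; have := splitP (cast_ord (size_cat _ _) i);
  case=> k hk; apply/orP; [left|right|left|right]; apply/codomP;
  by [exists (inl k); congr inl; apply: ord_inj
     |exists (inr k); congr inr; apply: ord_inj].
Qed.

Lemma tensor_subproof :
  partition ([set tensl @: B | B : {set _} in blocks p] :|:
                    [set tensr @: B | B : {set _} in blocks q]) [set: pqpt].
Proof.
have [cp tp np] := and3P (etrans (imset_partition _ _ tensl_inj) (blocksP p)).
have [cq tq nq] := and3P (etrans (imset_partition _ _ tensr_inj) (blocksP q)).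
apply/and3P; split; last by rewrite inE negb_or np nq.
- rewrite /cover bigcup_setU -!/(cover _) (eqP cp) (eqP cq).
  apply/eqP/setP=> x; rewrite !inE; have := tens_cover x.
  by case/orP=> /codomP [y ->]; rewrite imset_f ?inE ?orbT.
- rewrite /trivIset; apply/trivIsetP => A B; rewrite !inE.
  have dis (A' : {set pt p}) (B' : {set pt q}) :
      [disjoint tensl @: A' & tensr @: B'].
    rewrite disjoint_subset; apply/subsetP=> _ /imsetP [x _ ->].
    rewrite inE; apply/imsetP=> -[y _ h].
    by have := tenslr_neq x y; rewrite h eqxx.
  case/orP=> hA; case/orP=> hB nAB.
  + exact: (trivIsetP tp).
  + by case/imsetP: hA hB => A' _ -> /imsetP [B' _ ->].
  + by rewrite disjoint_sym; case/imsetP: hA hB => A' _ -> /imsetP [B' _ ->].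
  + exact: (trivIsetP tq).
Qed.

Definition tensor : tcpart := TCPart tensor_subproof.

End Tensor.

Section Composition.
Variables p q : tcpart.

Definition composable : Prop := upper p = lower q.

(* Points of [p] and [q] together; the i-th upper point of [p] is glued to the
   i-th lower point of [q]. *)
Definition glue : rel (pt p + pt q)%type := fun a b =>
  match a, b with
  | inl x, inl y => same_block x y
  | inr x, inr y => same_block x y
  | inl (inl i), inr (inr j) => i == j :> nat
  | inr (inr j), inl (inl i) => i == j :> nat
  | _, _ => false
  end.

Definition comp_pt (x : points (upper q) (lower p)) : (pt p + pt q)%type :=
  match x with inl i => inr (inl i) | inr j => inl (inr j) end.

Definition comp_rel : rel (points (upper q) (lower p)) :=
  fun x y => connect glue (comp_pt x) (comp_pt y).

Lemma same_block_sym (r : tcpart) : symmetric (@same_block r).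
Proof.
move=> x y; case/and3P: (blocksP r) => /eqP cov ti _; rewrite /same_block.
have c z : z \in cover (blocks r) by rewrite cov inE.
by rewrite -!eq_pblock // eq_sym.
Qed.

Lemma glue_sym : symmetric glue.
Proof. by move=> [[i|i]|[i|i]] [[j|j]|[j|j]] //=; exact: same_block_sym. Qed.

Lemma comp_equiv :
  {in [set: points (upper q) (lower p)] & &, equivalence_rel comp_rel}.
Proof.
move=> x y z _ _ _; split; first exact: connect0.
by move=> xy; apply: (same_connect (sym_connect_sym glue_sym)).
Qed.

(* Only meaningful when [composable] holds. Blocks lying entirely in the
   deleted middle row leave no trace. *)
Definition composition : tcpart :=
  TCPart (equivalence_partitionP comp_equiv).

End Composition.

Definition part_s : tcpart := singletons [::] [:: White; Black].

Definition part_f : tcpart := one_block [::] [:: White; Black; White; Black].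

Section Orientation.
Variable p : tcpart.
Implicit Types (x y : pt p) (S B : {set pt p}).

(* Position in the cyclic order, the leftmost lower point having position 0;
   the upper row is traversed from right to left. *)
Definition position x : nat :=
  match x with inl i => size (lower p) + rev_ord i | inr j => j end.

Definition npoints : nat := size (lower p) + size (upper p).

(* Number of steps to get from [x] to [y] along the cyclic order. *)
Definition steps x y : nat :=
  (position y + (npoints - position x)) %% npoints.

(* The tuple with first entry [x] and further entries [s] is ordered; as the
   numbers of steps strictly increase from [steps x x = 0], the entries are
   pairwise distinct. *)
Definition ordered x (s : seq (pt p)) : bool :=
  path (fun y z => steps x y < steps x z) x s.

Definition oo_interval x y : {set pt p} := [set z | ordered x [:: z; y]].

Definition oc_interval x y : {set pt p} := y |: oo_interval x y.

Definition ncolor x : color :=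
  match x with
  | inl i => opp_color (tnth (in_tuple (upper p)) i)
  | inr j => tnth (in_tuple (lower p)) j
  end.

Definition color_sum S : int := (\sum_(x in S) color_sign (ncolor x))%R.

Definition total_color_sum : int := color_sum [set: pt p].

(* The division is exact: the difference is -2, 0 or 2. *)
Definition color_distance x y : int :=
  (color_sum (oc_interval x y)
   + ((color_sum [set x] - color_sum [set y]) %/ 2)%Z)%R.

Definition crossing B1 B2 : Prop :=
  B1 != B2 /\
  exists a1 b1 a2 b2, [/\ a1 \in B1, b1 \in B1, a2 \in B2, b2 \in B2 &
                          ordered a1 [:: a2; b1; b2]].

(* [x] and [y] are distinct points of the block [B] and no point of [B] lies
   strictly between them when running from [x] to [y]. *)
Definition subsequent B x y : Prop :=
  [/\ B \in blocks p, x \in B, y \in B, x != y &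
      oo_interval x y :&: B = set0].

Definition pair_sum x y : int := color_sum [set x; y].

End Orientation.

(* Imported only here, as it shadows finset's names (set0, partition, ...). *)
From mathcomp Require Import boolp classical_sets.
Local Close Scope set_scope.
Local Open Scope ring_scope.
Local Open Scope classical_set_scope.

Record category (C : set tcpart) : Prop := Category {
  category_tensor : forall p q, C p -> C q -> C (tensor p q);
  category_involution : forall p, C p -> C (involution p);
  category_composition :
    forall p q, C p -> C q -> composable p q -> C (composition p q);
  category_id : forall c, C (one_block [:: c] [:: c]);
  category_pair : forall c, C (one_block [::] [:: c; opp_color c])
}.

Definition non_hyperoctahedral (C : set tcpart) : Prop :=
  C part_s \/ ~ C part_f.

Record sextuple := Sextuple {
  Fset : set int;
  Vset : set int;
  Sset : set int;
  Lset : set int;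
  Kset : set int;
  Xset : set int
}.

Definition analyzer (S : set tcpart) : sextuple := {|
  Fset := [set z | exists p (B : {set pt p}),
             [/\ S p, B \in blocks p & z = #|B|%:Z]];
  Vset := [set z | exists p (B : {set pt p}),
             [/\ S p, B \in blocks p & z = color_sum B]];
  Sset := [set total_color_sum p | p in S];
  Lset := [set z | exists p (B : {set pt p}) (x y : pt p),
             [/\ S p, subsequent B x y, pair_sum x y != 0 &
                 z = color_distance x y]];
  Kset := [set z | exists p (B : {set pt p}) (x y : pt p),
             [/\ S p, subsequent B x y, pair_sum x y = 0 &
                 z = color_distance x y]];
  Xset := [set z | exists p (B1 B2 : {set pt p}) (x y : pt p),
             [/\ S p, B1 \in blocks p /\ B2 \in blocks p, crossing B1 B2,
                 x \in B1 /\ y \in B2 & z = color_distance x y]]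
|}.

Section IntegerSets.
Implicit Types (x y m : int) (A B D : set int).

Definition lin_set x A y B : set int :=
  [set x * a + y * b | a in A & b in B].

Definition shift_set x y B : set int := [set x + y * b | b in B].

Definition mulZ m : set int := [set m * z | z in setT].

Definition pm A : set int := A `|` [set - a | a in A].

(* D_m and D'_m *)
Definition sub_m D m : set int :=
  lin_set 1 (D `|` shift_set m (- 1) D) m setT.

Definition sub_m' D m : set int :=
  lin_set 1 (D `|` shift_set m (- 1) D `|` [set 0]) m setT.

Definition posints : set int := [set z | 0 < z].

Definition upto (k : nat) : set int := [set z | 1 <= z <= k%:Z].

Definition subsemigroup A : Prop :=
  A `<=` posints /\ forall x y, A x -> A y -> A (x + y).

End IntegerSets.

Inductive Qrange : sextuple -> Prop :=
| Q1 (u m : nat) : (0 < m)%N ->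
    Qrange (Sextuple [set 2] (pm [set 0; 2]) (mulZ (2 * u%:Z * m%:Z))
              (mulZ m) (mulZ m) setT)
| Q2 (u m : nat) : (0 < m)%N ->
    Qrange (Sextuple [set 2] (pm [set 0; 2]) (mulZ (2 * u%:Z * m%:Z))
              (shift_set m (2 * m%:Z) setT) (mulZ (2 * m%:Z)) setT)
| Q3 (u m : nat) : (0 < m)%N ->
    Qrange (Sextuple [set 2] (pm [set 0; 2]) (mulZ (2 * u%:Z * m%:Z))
              (shift_set m (2 * m%:Z) setT) (mulZ (2 * m%:Z))
              (setT `\` mulZ m))
| Q4 (m : nat) : (0 < m)%N ->
    Qrange (Sextuple [set 2] [set 0] [set 0] set0 (mulZ m) setT)
| Q5 (N : set int) : subsemigroup N ->
    Qrange (Sextuple [set 2] (pm [set 0; 2]) [set 0] [set 0] [set 0]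
              (setT `\` sub_m N 0))
| Q6 (N : set int) : subsemigroup N ->
    Qrange (Sextuple [set 2] [set 0] [set 0] set0 [set 0]
              (setT `\` sub_m N 0))
| Q7 (N : set int) : subsemigroup N ->
    Qrange (Sextuple [set 2] [set 0] [set 0] set0 [set 0]
              (setT `\` sub_m' N 0))
| Q8 (u m : nat) (D : set int) : (0 < m)%N ->
    D `<=` [set 0] `|` upto (m %/ 2)%N ->
    Qrange (Sextuple [set 1; 2] (pm [set 0; 1; 2]) (mulZ (u%:Z * m%:Z))
              (mulZ m) (mulZ m) (setT `\` sub_m D m))
| Q9 (u m : nat) (D : set int) : (0 < m)%N ->
    D `<=` [set 0] `|` upto (m %/ 2)%N ->
    Qrange (Sextuple [set 1; 2] (pm [set 0; 1; 2]) (mulZ (2 * u%:Z * m%:Z))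
              (shift_set m (2 * m%:Z) setT) (mulZ (2 * m%:Z))
              (setT `\` sub_m D m))
| Q10 (u m : nat) (D : set int) : (0 < m)%N ->
    D `<=` [set 0] `|` upto (m %/ 2)%N ->
    Qrange (Sextuple [set 1; 2] (pm [set 0; 1]) (mulZ (u%:Z * m%:Z))
              set0 (mulZ m) (setT `\` sub_m D m))
| Q11 (E : set int) : E `<=` [set 0] `|` posints ->
    Qrange (Sextuple [set 1; 2] (pm [set 0; 1; 2]) [set 0] [set 0] [set 0]
              (setT `\` sub_m E 0))
| Q12 (E : set int) : E `<=` [set 0] `|` posints ->
    Qrange (Sextuple [set 1; 2] (pm [set 0; 1]) [set 0] set0 [set 0]
              (setT `\` sub_m E 0))
| Q13 (u m : nat) (D : set int) : (0 < m)%N ->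
    D `<=` [set 0] `|` upto (m %/ 2)%N ->
    Qrange (Sextuple posints setT (mulZ (u%:Z * m%:Z))
              (mulZ m) (mulZ m) (setT `\` sub_m D m))
| Q14 (E : set int) : E `<=` [set 0] `|` posints ->
    Qrange (Sextuple posints setT [set 0] [set 0] [set 0]
              (setT `\` sub_m E 0)).

(* Main.v *)
From HB Require Import structures.
Require Import Defs.
From mathcomp Require Import all_boot all_order all_algebra.
From mathcomp Require Import zify ring.

(** A partition is read as a cyclic word of letters (label, normalized color), the
label naming the block.  Composing with caps turns a category into a set of
words that is closed under rotation, under reversal with change of colors,
under juxtaposition, and under the contraction of two adjacent letters of
opposite colors, which merges their blocks ([realizes_contraction]).  In this
language every component of the analyzer is read off from single words.

Contractions give two tools.  Gluing a letter of one word to a letter of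
opposite color of another ([realizable_gluing]) concatenates the two words at
that place.  Folding a word [u v] to [u u*] ([realizable_fold]) removes an
unwanted arc [v].  Folding shows that a singleton block yields the partition
[s] ([singleton_word_s]), and that a block with three points yields [f]
([triple_word_f]).  A non-hyperoctahedral category therefore has blocks of all
sizes ([s] and [f] present), of sizes 1 and 2 (only [s]), or of size 2 (none).

By gluing, the distances of subsequent legs of opposite colors form a subgroup
[m Z] containing all total color sums, those of legs of equal colors are empty
or a coset of it, and a block of two points, or the partition [f] with a point
detached, makes twice that coset trivial ([distances_shape]).  This gives K and
L, and X is invariant under translation by K and L and under sign change,
hence the complement of a set [D_m] or [E_0].

What remains is special to pairings.  Running along a word, the height changes
by one at each letter, and the two ends of a strand lie at congruent levels
modulo the distances.  If a segment meets a class of levels an odd number of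
times, then some strand of that class leaves the segment ([leaving_strand]),
and it has to cross a strand that bounds the segment ([cross_of_odd]).  Applied
to suitable segments, this yields the missing elements of X, the semigroup
property of its complement, and the divisibility of the total color sums by
[2 m]. *)

Set Implicit Arguments.
Unset Strict Implicit.
Unset Printing Implicit Defensive.

Import Order.TTheory GRing.Theory Num.Theory.
Local Open Scope nat_scope.

(** * Labeled words presenting partitions *)

Definition is_white (c : color) := if c is White then true else false.

Lemma is_whiteK : cancel is_white (fun b : bool => if b then White else Black).
Proof. by case. Qed.

HB.instance Definition _ := Equality.copy color (can_type is_whiteK).

Lemma opp_colorK : involutive opp_color.
Proof. by case. Qed.

Notation word := (seq (nat * color)).
Notation letter0 := (0, White).

Definition opp_letter (a : nat * color) := (a.1, opp_color a.2).
Definition relabel (f : nat -> nat) (w : word) : word :=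
  [seq (f a.1, a.2) | a <- w].
Notation labels w := [seq a.1 | a <- w].
Notation colors w := [seq a.2 | a <- w].

Lemma colors_relabel f w : colors (relabel f w) = colors w.
Proof. by rewrite -map_comp. Qed.

Lemma labels_relabel f w : labels (relabel f w) = map f (labels w).
Proof. by rewrite -!map_comp. Qed.

Lemma size_relabel f w : size (relabel f w) = size w.
Proof. exact: size_map. Qed.

Lemma nth_relabel f w k :
  k < size w -> (nth letter0 (relabel f w) k).1 = f (nth letter0 w k).1.
Proof. by move=> h; rewrite (nth_map letter0). Qed.

Lemma relabel_cat f w1 w2 : relabel f (w1 ++ w2) = relabel f w1 ++ relabel f w2.
Proof. exact: map_cat. Qed.

Lemma relabel_comp f g w : relabel f (relabel g w) = relabel (f \o g) w.
Proof. by rewrite /relabel -map_comp. Qed.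

Lemma relabel_id_in f w : {in labels w, f =1 id} -> relabel f w = w.
Proof.
move=> h; rewrite -[RHS]map_id; apply/eq_in_map => -[a c] ha /=.
by rewrite h //; apply/mapP; exists (a, c).
Qed.

Lemma eq_in_relabel f g w : {in labels w, f =1 g} -> relabel f w = relabel g w.
Proof.
move=> h; apply/eq_in_map => -[a c] ha /=.
by rewrite h //; apply/mapP; exists (a, c).
Qed.

Section Representation.
Implicit Types (p q r : tcpart) (u l : word).

Definition label u l p (x : pt p) : nat :=
  match x with
  | inl i => (nth letter0 u i).1
  | inr j => (nth letter0 l j).1
  end.

(** Labels name blocks; only their equality carries meaning. *)
Definition represents p u l :=
  [/\ upper p = colors u, lower p = colors l &
      forall x y : pt p, same_block x y = (label u l x == label u l y)].

Lemma mem_cover_blocks p (x : pt p) : x \in cover (blocks p).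
Proof. by case/and3P: (blocksP p) => /eqP -> _ _; rewrite inE. Qed.

Lemma triv_blocks p : trivIset (blocks p).
Proof. by case/and3P: (blocksP p). Qed.

Lemma same_blockE p (x y : pt p) :
  same_block x y = (pblock (blocks p) x == pblock (blocks p) y).
Proof. by rewrite eq_pblock ?triv_blocks ?mem_cover_blocks. Qed.

Lemma same_blockP p (x y : pt p) B :
  B \in blocks p -> x \in B -> same_block x y = (y \in B).
Proof.
by move=> hB hx; rewrite /same_block (def_pblock (triv_blocks p) hB hx).
Qed.

Lemma exists_representation p : exists u l, represents p u l.
Proof.
pose num (x : pt p) : nat := enum_rank (pblock (blocks p) x).
pose u := zip [seq num (inl i) | i <- enum 'I_(size (upper p))] (upper p).
pose l := zip [seq num (inr i) | i <- enum 'I_(size (lower p))] (lower p).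
have su : size [seq num (inl i) | i <- enum 'I_(size (upper p))] = size (upper p).
  by rewrite size_map size_enum_ord.
have sl : size [seq num (inr i) | i <- enum 'I_(size (lower p))] = size (lower p).
  by rewrite size_map size_enum_ord.
exists u, l; split.
- by rewrite -/(unzip2 _) unzip2_zip ?su.
- by rewrite -/(unzip2 _) unzip2_zip ?sl.
have lab x : label u l x = num x.
  case: x => i /=; rewrite nth_zip //= (nth_map i) ?size_enum_ord //;
  by rewrite nth_ord_enum.
move=> x y; rewrite !lab same_blockE /num.
by rewrite -(inj_eq (@enum_rank_inj _)) -(inj_eq (@ord_inj _)).
Qed.

Lemma tcpart_ext (u l : seq color) (B1 B2 : {set {set points u l}}) h1 h2 :
  (forall x y, same_block (p := @TCPart u l B1 h1) x y =
               same_block (p := @TCPart u l B2 h2) x y) ->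
  @TCPart u l B1 h1 = @TCPart u l B2 h2.
Proof.
move=> h; suff e : B1 = B2.
  by move: h1 h2 {h}; rewrite e => h1 h2; rewrite (bool_irrelevance h1 h2).
have sub (C1 C2 : {set {set points u l}}) k1 k2 :
  (forall x y, same_block (p := @TCPart u l C1 k1) x y =
               same_block (p := @TCPart u l C2 k2) x y) -> C1 \subset C2.
  move=> h'; apply/subsetP => B hB.
  have /set0Pn [x hx] : B != set0.
    by case/and3P: (k1) => _ _; apply: contraNneq => <-.
  have -> : B = pblock C2 x.
    apply/setP => y.
    by rewrite -(@same_blockP (@TCPart u l C1 k1) x y B hB hx) h'.
  apply: pblock_mem; exact: (@mem_cover_blocks (@TCPart u l C2 k2)).
by apply/eqP; rewrite eqEsubset (sub _ _ h1 h2) // (sub _ _ h2 h1).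
Qed.

(** Only the kernel of a labeling is visible in the partition, so a
presentation determines it. *)
Lemma represents_inj p q u l : represents p u l -> represents q u l -> p = q.
Proof.
case: p q => [u1 l1 B1 h1] [u2 l2 B2 h2] [/= e1 e2 h] [/= e3 e4 h'].
move: B1 h1 B2 h2 h h'; rewrite e1 e2 e3 e4 => B1 h1 B2 h2 h h'.
by apply: tcpart_ext => x y; rewrite h h'.
Qed.

Lemma represents_one_block (u l : seq color) (n : nat) :
  represents (one_block u l) [seq (n, c) | c <- u] [seq (n, c) | c <- l].
Proof.
split; rewrite /= -?map_comp ?map_id // => x y.
rewrite /same_block /= /preim_partition.
rewrite (@pblock_equivalence_partition _ [rel x y | tt == tt]) ?inE //.
have lab (z : points u l) :
  @label [seq (n, c) | c <- u] [seq (n, c) | c <- l] (one_block u l) z = n.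
  by case: z => i /=; rewrite (nth_map White).
by rewrite !lab !eqxx.
Qed.

Lemma represents_singletons c1 c2 (n1 n2 : nat) : n1 != n2 ->
  represents (singletons [::] [:: c1; c2]) [::] [:: (n1, c1); (n2, c2)].
Proof.
move=> n12; split=> // x y.
rewrite /same_block /= /preim_partition.
rewrite (@pblock_equivalence_partition _ [rel x y | x == y]) ?inE //; last first.
  by split=> //= /eqP ->.
case: x y => [[]//|[[|[|k]] hk]] [[]//|[[|[|k']] hk']] //=.
- by rewrite eqxx.
- by rewrite (negbTE n12).
- by rewrite [RHS]eq_sym (negbTE n12).
- by rewrite eqxx.
Qed.

Lemma represents_involution p u l :
  represents p u l -> represents (involution p) l u.
Proof.
case=> eu el h; split=> //= x y.
have pb z : pblock (blocks (involution p)) (flip z) =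
            @flip p @: pblock (blocks p) z.
  apply: def_pblock; first exact: triv_blocks.
    by apply: imset_f; apply: pblock_mem; apply: mem_cover_blocks.
  by apply: imset_f; rewrite mem_pblock; apply: mem_cover_blocks.
have fl (z : pt (involution p)) : exists2 z' : pt p, z = flip z' &
    label l u z = label u l z'.
  by case: z => i; [exists (inr i)|exists (inl i)].
have [x' -> ->] := fl x; have [y' -> ->] := fl y.
by rewrite /same_block pb mem_imset; [exact: h | exact: flip_inj].
Qed.

Lemma represents_tensor p q u l u' l' :
  represents p u l -> represents q u' l' ->
  {in labels (u ++ l) & labels (u' ++ l'), forall a b, a != b} ->
  represents (tensor p q) (u ++ u') (l ++ l').
Proof.
move=> [eu el h] [eu' el' h'] dis; split.
- by rewrite map_cat -eu -eu'.
- by rewrite map_cat -el -el'.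
have su : size u = size (upper p) by rewrite eu size_map.
have sl : size l = size (lower p) by rewrite el size_map.
have su' : size u' = size (upper q) by rewrite eu' size_map.
have sl' : size l' = size (lower q) by rewrite el' size_map.
have pbl (z : pt p) : pblock (blocks (tensor p q)) (tensl q z) =
            @tensl p q @: pblock (blocks p) z.
  apply: def_pblock; first exact: triv_blocks.
    rewrite inE; apply/orP; left.
    by apply: imset_f; apply: pblock_mem; apply: mem_cover_blocks.
  by apply: imset_f; rewrite mem_pblock; apply: mem_cover_blocks.
have pbr (z : pt q) : pblock (blocks (tensor p q)) (tensr p z) =
            @tensr p q @: pblock (blocks q) z.
  apply: def_pblock; first exact: triv_blocks.
    rewrite inE; apply/orP; right.
    by apply: imset_f; apply: pblock_mem; apply: mem_cover_blocks.
  by apply: imset_f; rewrite mem_pblock; apply: mem_cover_blocks.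
have ll (z : pt p) :
  @label (u ++ u') (l ++ l') (tensor p q) (tensl q z) = label u l z.
  by case: z => i /=; rewrite nth_cat ?su ?sl ltn_ord.
have lr (z : pt q) :
  @label (u ++ u') (l ++ l') (tensor p q) (tensr p z) = label u' l' z.
  by case: z => i /=; rewrite nth_cat ?su ?sl ltnNge leq_addr /= addKn.
have inl_ (z : pt p) : label u l z \in labels (u ++ l).
  case: z => i /=; rewrite map_cat mem_cat; apply/orP; [left|right];
  by rewrite map_f // mem_nth // ?su ?sl.
have inr_ (z : pt q) : label u' l' z \in labels (u' ++ l').
  case: z => i /=; rewrite map_cat mem_cat; apply/orP; [left|right];
  by rewrite map_f // mem_nth // ?su' ?sl'.
move=> x y.
case/orP: (tens_cover x) => /codomP [x' ->];
case/orP: (tens_cover y) => /codomP [y' ->]; rewrite /same_block ?pbl ?pbr ?ll ?lr.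
- by rewrite mem_imset; [exact: h | exact: tensl_inj].
- rewrite (negbTE (dis _ _ (inl_ _) (inr_ _))).
  by apply/negbTE/imsetP => -[z _ e]; have := tenslr_neq z y'; rewrite e eqxx.
- rewrite eq_sym (negbTE (dis _ _ (inl_ _) (inr_ _))).
  by apply/negbTE/imsetP => -[z _ e]; have := tenslr_neq y' z; rewrite e eqxx.
- by rewrite mem_imset; [exact: h' | exact: tensr_inj].
Qed.

End Representation.

(** * Contracting two adjacent points of opposite colors *)

(** The letters of [w] with consecutive labels: these name the strands of an
identity partition. *)
Definition numbered s (w : word) : word := zip (iota s (size w)) (colors w).

Lemma size_numbered s w : size (numbered s w) = size w.
Proof. by rewrite size_zip size_iota size_map minnn. Qed.

Lemma colors_numbered s w : colors (numbered s w) = colors w.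
Proof. by rewrite -/(unzip2 _) unzip2_zip // size_iota size_map. Qed.

Lemma labels_numbered s w : labels (numbered s w) = iota s (size w).
Proof. by rewrite -/(unzip1 _) unzip1_zip // size_iota size_map. Qed.

Lemma nth_numbered s w k :
  k < size w -> (nth letter0 (numbered s w) k).1 = s + k.
Proof. by move=> h; rewrite nth_zip ?size_iota ?size_map //= nth_iota. Qed.

(** Here [r] is the tensor product of an identity, a cap and an identity, and
[f] merges the labels [i] and [j] of the two letters under the cap.  The
composition of [r] with [p] is presented by applying [f]: the function
[merged_label] extends [f] to all points of [r] and [p], is constant along
gluings, and separates the components of the glued points. *)
Section Contraction.
Variables (p r : tcpart) (u l1 l2 : word) (i j : nat) (c : color).
Variable f : nat -> nat.

Let l := l1 ++ (i, c) :: (j, opp_color c) :: l2.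
Let n := size l1.
Let m1 := numbered 0 l1.
Let m2 := numbered n.+1 l2.
Let mu := m1 ++ (n, c) :: (n, opp_color c) :: m2.

Hypothesis rp : represents p u l.
Hypothesis rr : represents r mu (m1 ++ m2).
Hypothesis fij : f i = f j.
Hypothesis kerf : {in labels (u ++ l) &, forall a b, f a = f b ->
  a = b \/ (a \in [:: i; j]) && (b \in [:: i; j])}.

(* The merged label of the k-th strand of r; the cap is the strand number n. *)
Let F (k : nat) := f (nth letter0 (l1 ++ (i, c) :: l2) k).1.

Let upper_num k : k < size mu -> f (nth letter0 l k).1 = F (nth letter0 mu k).1.
Proof.
rewrite /mu /l /F /m1 /m2 size_cat /= !size_numbered => h.
rewrite [nth _ (numbered 0 l1 ++ _) k]nth_cat size_numbered; case: ltnP => hk.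
  by rewrite nth_numbered // add0n !nth_cat hk.
rewrite nth_cat ltnNge hk /= -/n.
case e : (k - n) => [|[|t]] /=.
- by rewrite nth_cat ltnn subnn.
- by rewrite nth_cat ltnn subnn /= fij.
- have ht : t < size l2 by rewrite -/n in h hk; lia.
  rewrite nth_numbered // nth_cat ltnNge -/n.
  have -> : n <= n.+1 + t by lia.
  by have -> : n.+1 + t - n = t.+1 by lia.
Qed.

Let lower_num k : k < size (m1 ++ m2) ->
  f (nth letter0 (l1 ++ l2) k).1 = F (nth letter0 (m1 ++ m2) k).1.
Proof.
rewrite /F /m1 /m2 size_cat /= !size_numbered => h.
rewrite [nth _ (numbered 0 l1 ++ _) k]nth_cat size_numbered; case: ltnP => hk.
  by rewrite nth_numbered // add0n !nth_cat hk.
rewrite nth_cat ltnNge hk /= -/n.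
have ht : k - n < size l2 by rewrite -/n in h hk; lia.
rewrite nth_numbered // nth_cat ltnNge -/n.
have -> : n <= n.+1 + (k - n) by lia.
by have -> : n.+1 + (k - n) - n = (k - n).+1 by lia.
Qed.

Let size_up : size (upper p) = size u.
Proof. by case: rp => e _ _; rewrite e size_map. Qed.
Let size_lp : size (lower p) = size l.
Proof. by case: rp => _ e _; rewrite e size_map. Qed.
Let size_ur : size (upper r) = size l.
Proof.
case: rr => e _ _; rewrite e.
by rewrite size_map /l !size_cat /= !size_numbered.
Qed.
Let size_lr : size (lower r) = size (l1 ++ l2).
Proof. by case: rr => _ e _; rewrite e size_map !size_cat !size_numbered. Qed.

Let merged_label (a : (pt r + pt p)%type) : nat :=
  match a with
  | inr y => f (label u l y)
  | inl (inl k) => f (nth letter0 l k).1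
  | inl (inr k) => f (nth letter0 (l1 ++ l2) k).1
  end.

Let merged_label_r (x : pt r) : merged_label (inl x) = F (label mu (m1 ++ m2) x).
Proof.
case: x => k /=.
  apply: upper_num; rewrite (leq_trans (ltn_ord k)) // size_ur.
  by rewrite /l /mu !size_cat /= !size_numbered.
apply: lower_num; rewrite (leq_trans (ltn_ord k)) // size_lr.
by rewrite !size_cat !size_numbered.
Qed.

Let glue_l (x y : pt r) : @glue r p (inl x) (inl y) = same_block x y.
Proof. by case: x y => k [k'|k']. Qed.
Let glue_r (x y : pt p) : @glue r p (inr x) (inr y) = same_block x y.
Proof. by case: x y => k [k'|k']. Qed.

Let glue_merged a b : glue a b -> merged_label a = merged_label b.
Proof.
case: a b => [x|x] [y|y].
- by case: rr => _ _ h; rewrite !merged_label_r glue_l h => /eqP ->.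
- by case: x => k //=; case: y => k' //= /eqP ->.
- by case: x => k //=; case: y => k' //= /eqP ->.
- by case: rp => _ _ h; rewrite glue_r h => /eqP e; rewrite /= e.
Qed.

Let connect_merged a b : connect (@glue r p) a b -> merged_label a = merged_label b.
Proof.
case/connectP => s; elim: s a => [|z s IH] a /= => [_ -> //|/andP[az zs] e].
by rewrite (glue_merged az); apply: IH.
Qed.

Let csym := sym_connect_sym (@glue_sym r p).

Let connect_label (x y : pt p) :
  label u l x = label u l y -> connect (@glue r p) (inr x) (inr y).
Proof. by move=> e; apply: connect1; case: rp => _ _ h; rewrite glue_r h e. Qed.

Let n_lp : n < size (lower p).
Proof. by rewrite size_lp /l size_cat /= -/n; lia. Qed.
Let n1_lp : n.+1 < size (lower p).
Proof. by rewrite size_lp /l size_cat /= -/n; lia. Qed.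
Let n_ur : n < size (upper r).
Proof. by rewrite size_ur /l size_cat /= -/n; lia. Qed.
Let n1_ur : n.+1 < size (upper r).
Proof. by rewrite size_ur /l size_cat /= -/n; lia. Qed.

Let pi : pt p := inr (Ordinal n_lp).
Let pj : pt p := inr (Ordinal n1_lp).

Let label_pi : label u l pi = i.
Proof. by rewrite /= /l nth_cat ltnn subnn. Qed.
Let label_pj : label u l pj = j.
Proof. by rewrite /= /l nth_cat ltnNge leqnSn /= subSnn. Qed.

Let connect_ij : connect (@glue r p) (inr pi) (inr pj).
Proof.
apply: (connect_trans (y := inl (inl (Ordinal n_ur)))).
  by apply: connect1; rewrite /= eqxx.
apply: (connect_trans (y := inl (inl (Ordinal n1_ur)))); last first.
  by apply: connect1; rewrite /= eqxx.
apply: connect1; case: rr => _ _ h; rewrite /= h /= /mu !nth_cat !size_numbered -/n.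
by rewrite ltnn subnn ltnNge leqnSn /= subSnn.
Qed.

Let mem_label (x : pt p) : label u l x \in labels (u ++ l).
Proof.
case: x => k /=; rewrite map_cat mem_cat; apply/orP; [left|right];
by rewrite map_f // mem_nth // -?size_up -?size_lp.
Qed.

Let label_connect (x y : pt p) :
  f (label u l x) = f (label u l y) -> connect (@glue r p) (inr x) (inr y).
Proof.
have to_i z : label u l z \in [:: i; j] -> connect (@glue r p) (inr z) (inr pi).
  rewrite !inE => /orP [] /eqP e.
    by apply: connect_label; rewrite label_pi.
  apply: (connect_trans (y := inr pj)); last by rewrite csym; exact: connect_ij.
  by apply: connect_label; rewrite label_pj.
case/kerf; [exact: mem_label|exact: mem_label|exact: connect_label|].
by case/andP=> /to_i hx /to_i; rewrite csym; apply: connect_trans.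
Qed.

Let connect_to_p (x : pt (composition r p)) :
  exists y : pt p, connect (@glue r p) (@comp_pt r p x) (inr y).
Proof.
case: x => k /=; first by exists (inl k).
have hk : k < size (l1 ++ l2) by rewrite -size_lr.
have [k' hk' e] : exists2 k', k' < size l &
  (nth letter0 mu k').1 = (nth letter0 (m1 ++ m2) k).1.
  move: hk; rewrite /mu /l !size_cat nth_cat size_numbered.
  case: (ltnP k (size l1)) => kn hk.
    by exists k; [exact: ltn_addr | rewrite nth_cat size_numbered kn].
  exists k.+2; first by rewrite /= !addnS !ltnS.
  rewrite nth_cat size_numbered; have -> : (k.+2 < size l1) = false.
    by rewrite ltnNge (leq_trans kn) // !leqW.
  by rewrite !subSn ?leqW.
have hkr : k' < size (upper r) by rewrite size_ur.
have hkp : k' < size (lower p) by rewrite size_lp.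
exists (inr (Ordinal hkp)).
apply: (connect_trans (y := inl (inl (Ordinal hkr)))); last first.
  by apply: connect1; rewrite /= eqxx.
by apply: connect1; case: rr => _ _ h; rewrite /= h /= e.
Qed.

Lemma composable_contraction : composable r p.
Proof.
rewrite /composable; case: rr => e _ _; case: rp => _ e1 _; rewrite e e1.
by rewrite /mu /l !map_cat /= !colors_numbered.
Qed.

Lemma represents_contraction :
  represents (composition r p) (relabel f u) (relabel f (l1 ++ l2)).
Proof.
split.
- by rewrite colors_relabel; case: rp => e _ _; rewrite /= e.
- by rewrite colors_relabel; case: rr => _ e _; rewrite /= e !map_cat !colors_numbered.
have label_merged (x : pt (composition r p)) :
    merged_label (@comp_pt r p x) = label (relabel f u) (relabel f (l1 ++ l2)) x.
  case: x => k /=; first by rewrite nth_relabel // -size_up.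
  by rewrite nth_relabel // -size_lr.
move=> x y; rewrite -!label_merged.
rewrite /same_block /= pblock_equivalence_partition ?inE //; last exact: comp_equiv.
rewrite /comp_rel; apply/idP/eqP; first exact: connect_merged.
have [x' cx] := connect_to_p x; have [y' cy] := connect_to_p y.
rewrite (connect_merged cx) (connect_merged cy) => /label_connect cxy.
apply: (connect_trans cx); apply: (connect_trans cxy).
by rewrite csym.
Qed.

End Contraction.

(** * The words realized by a category *)

Lemma fresh_label (s : seq nat) : exists n, forall a, a \in s -> a < n.
Proof.
exists (sumn s).+1 => a; elim: s => //= b s IH; rewrite inE => /orP [/eqP ->|/IH];
by lia.
Qed.

Lemma notin_fresh n (s : seq nat) : (forall a, a \in s -> a < n) -> n \notin s.
Proof. by move=> h; apply/negP => /h; rewrite ltnn. Qed.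

(** The word of the involution, read as a lower row. *)
Definition reflect_word (w : word) : word := rev (map opp_letter w).

Section Category.
Variable C : tcpart -> Prop.
Hypothesis HC : category C.

Definition realizes (u l : word) := exists2 p, C p & represents p u l.

Definition realizable (w : word) := realizes [::] w.

Lemma realizes_relabel g u l : {in labels (u ++ l) &, injective g} ->
  realizes u l -> realizes (relabel g u) (relabel g l).
Proof.
move=> injg [p Cp [eu el h]]; exists p => //; split; rewrite ?colors_relabel //.
have su : size u = size (upper p) by rewrite eu size_map.
have sl : size l = size (lower p) by rewrite el size_map.
have lab (z : pt p) : label (relabel g u) (relabel g l) z = g (label u l z).
  by case: z => k /=; rewrite nth_relabel // ?su ?sl.
have mem (z : pt p) : label u l z \in labels (u ++ l).
  case: z => k /=; rewrite map_cat mem_cat; apply/orP; [left|right];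
  by rewrite map_f // mem_nth // ?su ?sl.
move=> x y; rewrite h !lab; apply/eqP/eqP => [-> //|].
by apply: injg; exact: mem.
Qed.

Lemma realizes_tensor u l u' l' : realizes u l -> realizes u' l' ->
  {in labels (u ++ l) & labels (u' ++ l'), forall a b, a != b} ->
  realizes (u ++ u') (l ++ l').
Proof.
move=> [p Cp rp] [q Cq rq] h; exists (tensor p q).
  by apply: category_tensor.
exact: represents_tensor.
Qed.

Lemma realizes_involution u l : realizes u l -> realizes l u.
Proof.
move=> [p Cp rp]; exists (involution p); first exact: category_involution.
exact: represents_involution.
Qed.

Lemma realizes_id1 a : realizes [:: a] [:: a].
Proof.
case: a => n c; exists (one_block [:: c] [:: c]); first exact: category_id.
exact: (represents_one_block [:: c] [:: c] n).
Qed.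

Lemma realizes_pair n c : realizes [::] [:: (n, c); (n, opp_color c)].
Proof.
exists (one_block [::] [:: c; opp_color c]); first exact: category_pair.
exact: (represents_one_block [::] [:: c; opp_color c] n).
Qed.

(** The empty partition is a cup closed by a cap. *)
Lemma realizes_nil : realizes [::] [::].
Proof.
pose p := one_block [::] [:: White; Black].
have Cp : C p by exact: (category_pair HC White).
exists (composition (involution p) p).
  by apply: category_composition => //; apply: category_involution.
by split=> // -[] [].
Qed.

Lemma realizes_id w : uniq (labels w) -> realizes w w.
Proof.
elim: w => [_|a w IH /= /andP [aw uw]]; first exact: realizes_nil.
apply: (realizes_tensor (u := [:: a]) (l := [:: a])) (IH uw) _.
  exact: realizes_id1.
move=> x y; rewrite /= !inE orbb => /eqP -> {x}.
by rewrite map_cat mem_cat orbb => h; apply: contraNneq aw => ->.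
Qed.

(** The freedom in [f] lets the merged block receive any convenient name. *)
Lemma realizes_contraction f u l1 l2 i j c :
  realizes u (l1 ++ (i, c) :: (j, opp_color c) :: l2) -> f i = f j ->
  {in labels (u ++ l1 ++ (i, c) :: (j, opp_color c) :: l2) &, forall a b,
     f a = f b -> a = b \/ (a \in [:: i; j]) && (b \in [:: i; j])} ->
  realizes (relabel f u) (relabel f (l1 ++ l2)).
Proof.
move=> [p Cp rp] fij kerf.
pose n := size l1.
have [r Cr rr] : realizes
    (numbered 0 l1 ++ (n, c) :: (n, opp_color c) :: numbered n.+1 l2)
    (numbered 0 l1 ++ numbered n.+1 l2).
  apply: realizes_tensor.
  - by apply: realizes_id; rewrite labels_numbered iota_uniq.
  - apply: (@realizes_tensor [:: (n, c); (n, opp_color c)] [::]).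
    + exact/realizes_involution/realizes_pair.
    + by apply: realizes_id; rewrite labels_numbered iota_uniq.
    + move=> a b; rewrite /= !inE orbb map_cat labels_numbered mem_cat orbb.
      by rewrite mem_iota => /eqP -> /andP [h _]; rewrite neq_ltn h.
  - move=> a b; rewrite map_cat !labels_numbered mem_cat orbb mem_iota.
    rewrite /= !inE map_cat !labels_numbered mem_cat !orbb mem_iota /n.
    by lia.
exists (composition r p); last exact: represents_contraction rp rr fij kerf.
by apply: category_composition => //; apply: composable_contraction rp rr.
Qed.

(** Put an identity strand to the left and contract it with the first lower
point: the strand bends this point up. *)
Lemma realizes_rotl u l i c :
  realizes u ((i, c) :: l) -> realizes ((i, opp_color c) :: u) l.
Proof.
move=> h; have [n hn] := fresh_label (labels (u ++ (i, c) :: l)).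
have nn : n \notin labels (u ++ (i, c) :: l) by exact: notin_fresh.
pose f a := if a == n then i else a.
have fid w : {subset labels w <= labels (u ++ (i, c) :: l)} -> relabel f w = w.
  move=> sw; apply: relabel_id_in => a /sw /hn an.
  by rewrite /f ltn_eqF.
have h1 : realizes ((n, opp_color c) :: u) ((n, opp_color c) :: (i, c) :: l).
  apply: (realizes_tensor (realizes_id1 (n, opp_color c)) h) => a b.
  by rewrite /= !inE orbb => /eqP -> hb; apply: contraNneq nn => ->.
have := @realizes_contraction f ((n, opp_color c) :: u) [::] l n i (opp_color c).
rewrite opp_colorK => /(_ h1) /=.
have fi : f i = i by rewrite /f; case: eqP.
have fn : f n = i by rewrite /f eqxx.
rewrite fi fn (fid u) ?(fid l); first last.
- by move=> a ha; rewrite map_cat mem_cat ha.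
- by move=> a ha; rewrite map_cat mem_cat /= inE ha !orbT.
apply=> // a b _ _; rewrite /f !inE.
case: (a =P n) => [->|an]; case: (b =P n) => [->|bn] e;
  by [left|right; lia].
Qed.

(** The mirror image of [realizes_rotl], with the strand on the right. *)
Lemma realizes_rotr_lower u l i c :
  realizes u (l ++ [:: (i, c)]) -> realizes (u ++ [:: (i, opp_color c)]) l.
Proof.
move=> h; have [n hn] := fresh_label (labels (u ++ l ++ [:: (i, c)])).
have nn : n \notin labels (u ++ l ++ [:: (i, c)]) by exact: notin_fresh.
pose f a := if a == n then i else a.
have fid w : {subset labels w <= labels (u ++ l ++ [:: (i, c)])} -> relabel f w = w.
  move=> sw; apply: relabel_id_in => a /sw /hn an.
  by rewrite /f ltn_eqF.
have h1 : realizes (u ++ [:: (n, opp_color c)])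
                   (l ++ (i, c) :: (n, opp_color c) :: [::]).
  have -> : l ++ [:: (i, c); (n, opp_color c)] = (l ++ [:: (i, c)]) ++ [:: (n, opp_color c)].
    by rewrite -catA.
  apply: (realizes_tensor h (realizes_id1 (n, opp_color c))) => a b.
  by rewrite /= !inE orbb => ha /eqP ->; apply: contraNneq nn => <-.
have := @realizes_contraction f _ l [::] i n c h1.
have fi : f i = i by rewrite /f; case: eqP.
have fn : f n = i by rewrite /f eqxx.
rewrite cats0 relabel_cat /= fi fn (fid u) ?(fid l); first last.
- by move=> a ha; rewrite map_cat mem_cat ha.
- by move=> a ha; rewrite !map_cat !mem_cat ha !orbT.
apply=> // a b _ _; rewrite /f !inE.
case: (a =P n) => [->|an]; case: (b =P n) => [->|bn] e;
  by [left|right; lia].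
Qed.

Lemma realizes_rotr u l i c :
  realizes (u ++ [:: (i, c)]) l -> realizes u (l ++ [:: (i, opp_color c)]).
Proof.
by move/realizes_involution/realizes_rotr_lower/realizes_involution.
Qed.

(** All upper points are bent down on the right, which keeps the cyclic order
and the normalized colors. *)
Lemma realizable_word u l : realizes u l -> realizable (l ++ reflect_word u).
Proof.
elim/last_ind: u l => [|u [i c] IH] l; first by rewrite cats0.
rewrite -cats1 => /realizes_rotr /IH.
by rewrite -catA /reflect_word map_cat rev_cat.
Qed.

Lemma realizable_rot w1 w2 : realizable (w1 ++ w2) -> realizable (w2 ++ w1).
Proof.
elim: w1 w2 => [|[i c] w1 IH] w2; first by rewrite cats0.
move/realizes_rotl/(@realizes_rotr [::]); rewrite opp_colorK -catA => /IH.
by rewrite -catA.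
Qed.

(** Bending all points of [w] up on the left reverses their order; the
involution then puts them back below. *)
Lemma realizable_reflect w : realizable w -> realizable (reflect_word w).
Proof.
suff h u : realizes u w -> realizes (reflect_word w ++ u) [::].
  by move/h; rewrite cats0 => /realizes_involution.
elim: w u => [|[i c] w IH] u //= /realizes_rotl /IH.
by rewrite /reflect_word rev_cons -cats1 -catA.
Qed.

Lemma realizable_cat w1 w2 : realizable w1 -> realizable w2 ->
  {in labels w1 & labels w2, forall a b, a != b} -> realizable (w1 ++ w2).
Proof. exact: realizes_tensor. Qed.

Lemma realizable_relabel g w : {in labels w &, injective g} ->
  realizable w -> realizable (relabel g w).
Proof. by move=> h; apply: realizes_relabel. Qed.

Lemma realizable_contraction f w1 w2 i j c :
  realizable (w1 ++ (i, c) :: (j, opp_color c) :: w2) -> f i = f j ->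
  {in labels (w1 ++ (i, c) :: (j, opp_color c) :: w2) &, forall a b,
     f a = f b -> a = b \/ (a \in [:: i; j]) && (b \in [:: i; j])} ->
  realizable (relabel f (w1 ++ w2)).
Proof. exact: realizes_contraction. Qed.

Lemma realizable_pair n c : realizable [:: (n, c); (n, opp_color c)].
Proof. exact: realizes_pair. Qed.

End Category.

(** * Reading a partition along its cyclic order *)

Definition sigma (w : word) : int := (\sum_(a <- w) color_sign a.2)%R.
Definition block_sum (i : nat) (w : word) : int :=
  (\sum_(a <- w | a.1 == i) color_sign a.2)%R.
(** Half of the sum of the two color signs, the correction by which a color
distance differs from the color sum of the open interval. *)
Definition half_sum (c d : color) : int := if c == d then color_sign c else 0%R.

Lemma nth_rot (T : Type) (x0 : T) (s : seq T) n k : n < size s -> k < size s ->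
  nth x0 (rot n s) k = nth x0 s ((k + n) %% size s).
Proof.
move=> hn hk; rewrite /rot nth_cat size_drop; case: ltnP => h.
  rewrite nth_drop addnC modn_small //; lia.
have e : k + n = (k - (size s - n)) + size s by lia.
by rewrite e modnDr modn_small ?nth_take //; lia.
Qed.

Section Steps.
Variable p : tcpart.
Implicit Types x y z : pt p.
Notation n := (npoints p).

Lemma position_lt x : position x < n.
Proof.
case: x => [i|i]; rewrite /position /npoints; first by rewrite ltn_add2l ltn_ord.
by rewrite ltn_addr.
Qed.

Lemma position_inj : injective (@position p).
Proof.
case=> [i|i] [j|j] /=.
- move=> e; congr inl; apply: ord_inj; have := ltn_ord i; have := ltn_ord j; lia.
- by have := ltn_ord j; lia.
- by have := ltn_ord i; lia.
- by move/ord_inj => ->.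
Qed.

Lemma steps_lt x y : steps x y < n.
Proof. by rewrite /steps ltn_mod (leq_ltn_trans _ (position_lt x)). Qed.

Lemma steps_position x y : (steps x y + position x) %% n = position y.
Proof.
rewrite /steps modnDml -addnA subnK ?modnDr ?modn_small ?position_lt //.
exact/ltnW/position_lt.
Qed.

Lemma steps_inj x : injective (steps x).
Proof.
move=> y z e; apply: position_inj.
by rewrite -(steps_position x y) e steps_position.
Qed.

Lemma stepsxx x : steps x x = 0.
Proof. by rewrite /steps subnKC ?modnn // ltnW ?position_lt. Qed.

Lemma steps_gt0 x y : (0 < steps x y) = (x != y).
Proof. by rewrite lt0n -{1}(stepsxx x) (inj_eq (@steps_inj x)) eq_sym. Qed.

(** Changing the starting point of the cyclic order is a rotation of
positions. *)
Lemma steps_steps x y z : (steps y z + steps x y) %% n = steps x z.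
Proof.
rewrite {2 3}/steps modnDmr addnA -modnDml steps_position.
by [].
Qed.

Lemma steps_surj x k : k < n -> exists y, steps x y = k.
Proof.
pose f y := Ordinal (steps_lt x y).
have injf : injective f by move=> y z [] /steps_inj.
have cf : #|{: pt p}| = #|'I_n|.
  by rewrite card_sum !card_ord addnC.
have [g _ gK] : bijective f by apply: inj_card_bij; rewrite // cf.
by move=> hk; exists (g (Ordinal hk)); have /(congr1 val) := gK (Ordinal hk).
Qed.

Lemma big_steps (R : Type) (idx : R) (op : Monoid.com_law idx) x (F : nat -> R) :
  \big[op/idx]_(y : pt p) F (steps x y) = \big[op/idx]_(0 <= k < n) F k.
Proof.
rewrite big_mkord; pose f y := Ordinal (steps_lt x y).
rewrite (reindex f); first by [].
have injf : injective f by move=> y z [] /steps_inj.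
apply: onW_bij; apply: inj_card_bij => //.
by rewrite card_sum !card_ord addnC.
Qed.

Lemma ordered1E x y z :
  ordered x [:: y; z] = (0 < steps x y) && (steps x y < steps x z).
Proof. by rewrite /ordered /= stepsxx andbT. Qed.

(** The order [g] is arbitrary so that counting from the leftmost lower point
and counting from any other point are both covered. *)
Definition reads_along (g : pt p -> nat) (w : word) :=
  [/\ size w = n,
      forall y, (nth letter0 w (g y)).2 = ncolor y &
      forall y z, same_block y z =
        ((nth letter0 w (g y)).1 == (nth letter0 w (g z)).1)].

Definition reads x w := reads_along (steps x) w.

Lemma reads_along_rot g w x : reads_along g w -> (forall y, g y < n) ->
  (forall y, (steps x y + g x) %% n = g y) -> reads x (rot (g x) w).
Proof.
move=> [sw cw lw] gn h.
have e y : nth letter0 (rot (g x) w) (steps x y) = nth letter0 w (g y).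
  by rewrite nth_rot ?sw ?steps_lt ?gn // h.
split; first by rewrite size_rot.
- by move=> y; rewrite e cw.
- by move=> y z; rewrite !e lw.
Qed.

Lemma reads_position x w : reads_along (@position p) w ->
  reads x (rot (position x) w).
Proof.
move=> rw; apply: reads_along_rot rw _ _ => z; first exact: position_lt.
exact: steps_position.
Qed.

Lemma represents_position u l : represents p u l ->
  reads_along (@position p) (l ++ reflect_word u).
Proof.
case=> eu el h.
have su : size u = size (upper p) by rewrite eu size_map.
have sl : size l = size (lower p) by rewrite el size_map.
have e x : nth letter0 (l ++ reflect_word u) (position x) =
           (label u l x, ncolor x).
  case: x => k; rewrite /position nth_cat /= (tnth_nth White) /=;
    case: k => k hk /=; last first.
    by rewrite sl hk el (nth_map letter0) ?sl //; case: (nth _ _ _).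
  have ku : k < size u by rewrite su.
  have -> : (size (lower p) + (size (upper p) - k.+1) < size l) = false by lia.
  rewrite sl addKn /reflect_word nth_rev ?size_map -?su; last by lia.
  have -> : size u - (size u - k.+1).+1 = k by lia.
  by rewrite (nth_map letter0) // eu (nth_map letter0).
split.
- by rewrite size_cat size_rev size_map /npoints su sl.
- by move=> y; rewrite e.
- by move=> y z; rewrite !e h.
Qed.

Section Reads.
Variables (x : pt p) (w : word).
Hypothesis xw : reads x w.

Lemma reads_size : size w = n.
Proof. by case: xw. Qed.

Lemma reads_color y : (nth letter0 w (steps x y)).2 = ncolor y.
Proof. by case: xw. Qed.

Lemma reads_block y z : same_block y z =
  ((nth letter0 w (steps x y)).1 == (nth letter0 w (steps x z)).1).
Proof. by case: xw. Qed.

Lemma reads_mem_block B y i : B \in blocks p -> y \in B ->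
  (nth letter0 w (steps x y)).1 = i ->
  forall z, (z \in B) = ((nth letter0 w (steps x z)).1 == i).
Proof. by move=> hB hy <- z; rewrite -(same_blockP _ hB hy) reads_block eq_sym. Qed.

Lemma reads_sum (F : nat * color -> int) :
  (\sum_(y : pt p) F (nth letter0 w (steps x y)) = \sum_(a <- w) F a)%R.
Proof.
by rewrite (big_steps _ x (fun k => F (nth letter0 w k))) -reads_size (big_nth letter0).
Qed.

Lemma reads_total : total_color_sum p = sigma w.
Proof.
rewrite /total_color_sum /color_sum /sigma -reads_sum; apply: eq_big => // y.
  by rewrite inE.
by rewrite reads_color.
Qed.

Lemma reads_block_sum B y i : B \in blocks p -> y \in B ->
  (nth letter0 w (steps x y)).1 = i -> color_sum B = block_sum i w.
Proof.
move=> hB hy e; rewrite /color_sum /block_sum big_mkcond [RHS]big_mkcond.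
rewrite -reads_sum; apply: eq_bigr => z _.
by rewrite (reads_mem_block hB hy e) reads_color.
Qed.

Lemma reads_block_card B y i : B \in blocks p -> y \in B ->
  (nth letter0 w (steps x y)).1 = i -> #|B| = count_mem i (labels w).
Proof.
move=> hB hy e; rewrite -sum1_card big_mkcond /=.
rewrite count_map -sum1_count [RHS]big_mkcond /=.
rewrite [RHS](big_nth letter0) reads_size -(big_steps _ x (fun k =>
  if preim (fun a : nat * color => a.1) (pred1 i) (nth letter0 w k) then 1 else 0)).
by apply: eq_bigr => z _; rewrite (reads_mem_block hB hy e).
Qed.

(** A point [y] other than [x] cuts the word read from [x] into the letter of
[x], the open interval, the letter of [y] and a remainder. *)
Section Split.
Variables (y : pt p) (i j : nat) (c d : color) (w1 w2 : word).
Hypothesis wE : w = (i, c) :: w1 ++ (j, d) :: w2.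
Hypothesis sy : steps x y = (size w1).+1.

Let nx : nth letter0 w (steps x x) = (i, c).
Proof. by rewrite stepsxx wE. Qed.
Let ny : nth letter0 w (steps x y) = (j, d).
Proof. by rewrite sy wE /= nth_cat ltnn subnn. Qed.

Lemma split_neq : x != y.
Proof. by rewrite -steps_gt0 sy. Qed.

Lemma split_color_x : ncolor x = c. Proof. by rewrite -reads_color nx. Qed.
Lemma split_color_y : ncolor y = d. Proof. by rewrite -reads_color ny. Qed.
Lemma split_block : same_block x y = (i == j).
Proof. by rewrite reads_block nx ny. Qed.

Lemma mem_interval z :
  (z \in oo_interval x y) = (0 < steps x z) && (steps x z <= size w1).
Proof. by rewrite inE ordered1E sy ltnS. Qed.

Lemma split_interval_sum : color_sum (oo_interval x y) = sigma w1.
Proof.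
rewrite /color_sum big_mkcond /=.
transitivity (\sum_(z : pt p) (fun k => if ((0 < k) && (k <= size w1))%N then
   color_sign (nth letter0 w k).2 else 0%R) (steps x z))%R.
  by apply: eq_bigr => z _; rewrite mem_interval reads_color.
rewrite (big_steps _ x (fun k => if ((0 < k) && (k <= size w1))%N then
   color_sign (nth letter0 w k).2 else 0%R)).
rewrite -reads_size wE /= size_cat /= big_nat_recl // /= add0r.
rewrite (big_cat_nat (n := size w1)) ?leq_addr //= [X in (_ + X)%R]big1_seq ?addr0.
  rewrite /sigma (big_nth letter0); apply: eq_big_nat => k /andP [_ hk].
  by rewrite hk nth_cat hk.
move=> k /=; rewrite mem_index_iota => /andP [hk _].
by rewrite ltnNge hk.
Qed.

Lemma split_distance : color_distance x y = (sigma w1 + half_sum c d)%R.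
Proof.
rewrite /color_distance /oc_interval /color_sum big_setU1 /=; last first.
  by rewrite mem_interval sy ltnn andbF.
rewrite -/(color_sum _) split_interval_sum !big_set1 split_color_x split_color_y.
rewrite addrAC [RHS]addrC; congr (_ + _)%R.
by case: (c) (d) => -[].
Qed.

Lemma split_pair_sum : pair_sum x y = (color_sign c + color_sign d)%R.
Proof.
rewrite /pair_sum /color_sum big_setU1 ?inE ?split_neq //= big_set1.
by rewrite split_color_x split_color_y.
Qed.

Lemma split_disjoint B : B \in blocks p -> x \in B ->
  (oo_interval x y :&: B == set0) = (i \notin labels w1).
Proof.
move=> hB hx; have mB := reads_mem_block hB hx (congr1 fst nx).
have in1 k : 0 < k <= size w1 -> nth letter0 w k = nth letter0 w1 k.-1.
  by case: k => // k; rewrite wE /= nth_cat => ->.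
apply/eqP/idP => [h|h].
- apply/negP => /(nthP 0) [k]; rewrite size_map => hk e.
  have kn : k.+1 < n by rewrite -reads_size wE /= size_cat /=; lia.
  have [z hz] := steps_surj x kn.
  suff : z \in set0 by rewrite inE.
  by rewrite -h inE mem_interval mB hz /= hk in1 /= -?e ?(nth_map letter0).
- apply/setP => z; rewrite in_set0 in_setI mem_interval mB.
  apply/negP => /andP [hz]; rewrite in1 // => /eqP e; case/negP: h.
  by rewrite -[i]e map_f // mem_nth //; case: (steps x z) hz.
Qed.

End Split.

Lemma reads_split y : x != y -> exists i j c d w1 w2,
  w = (i, c) :: w1 ++ (j, d) :: w2 /\ steps x y = (size w1).+1.
Proof.
rewrite -steps_gt0; have := steps_lt x y; rewrite -reads_size.
case: w => // -[i c] w' /=.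
case: (steps x y) => // k; rewrite ltnS => hk _.
case e : (nth letter0 w' k) => [j d].
exists i, j, c, d, (take k w'), (drop k.+1 w'); split.
  by rewrite -e -drop_nth // cat_take_drop.
by rewrite size_take hk.
Qed.

End Reads.

End Steps.

(** * The analyzer in terms of words *)

From mathcomp Require Import boolp classical_sets.
Local Open Scope classical_set_scope.
Local Open Scope nat_scope.

Section Crossing_words.
Implicit Types (i j : nat) (s t : seq nat).

(** Two labels cross in a cyclic word when they alternate; the two patterns
are those met when the word is cut open anywhere. *)
Definition crosses i j s :=
  (i != j) && (subseq [:: i; j; i; j] s || subseq [:: j; i; j; i] s).

Lemma crosses_sym i j s : crosses i j s = crosses j i s.
Proof. by rewrite /crosses eq_sym orbC. Qed.

Lemma subseq_consE i t s : subseq (i :: t) s ->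
  exists s1 s2, s = s1 ++ i :: s2 /\ subseq t s2.
Proof.
elim: s => //= a s IH; case: eqP => [-> h|_ /IH [s1 [s2 [-> h]]]].
  by exists [::], s.
by exists (a :: s1), s2.
Qed.

Lemma subseq_cons_cat i t s1 s2 : subseq t s2 -> subseq (i :: t) (s1 ++ i :: s2).
Proof.
move=> h; apply: (@cat_subseq _ [::] _ s1 (i :: s2)); first exact: sub0seq.
by rewrite /= eqxx.
Qed.

(** The word can be cut open at an occurrence of [i] such that the remaining
three letters of the alternating pattern follow. *)
Lemma crosses_head i j s : crosses i j s ->
  exists s1 s2, s = s1 ++ i :: s2 /\ subseq [:: j; i; j] (s2 ++ s1).
Proof.
case/andP=> _ /orP [] /subseq_consE [s1 [s2 [-> h]]].
  exists s1, s2; split => //; apply: subseq_trans h _; exact: prefix_subseq.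
have [s3 [s4 [-> h']]] := subseq_consE h.
exists (s1 ++ j :: s3), s4; split; first by rewrite -catA.
apply: (@cat_subseq _ [:: j; i] [:: j]) => //.
by apply: subseq_cons_cat; exact: sub0seq.
Qed.

Lemma crosses_rot i j s1 s2 : crosses i j (s1 ++ s2) -> crosses i j (s2 ++ s1).
Proof.
elim: s1 s2 => [|a s1 IH] s2; first by rewrite cats0.
rewrite -cat_rcons => h; apply: IH; move: h; rewrite -rcons_cat cat_cons.
rewrite /crosses; set s := s1 ++ s2; case/andP=> -> /=.
suff rot1 k l : subseq [:: k; l; k; l] (a :: s) ->
    subseq [:: k; l; k; l] (rcons s a) || subseq [:: l; k; l; k] (rcons s a).
  by case/orP=> /rot1 => // h; rewrite orbC.
rewrite /=; case: eqP => [-> h|_ h].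
  by apply/orP; right; rewrite -cats1; apply: (@cat_subseq _ [:: l; a; l] [:: a]).
by apply/orP; left; apply: subseq_trans h _; apply: subseq_rcons.
Qed.

End Crossing_words.

Section Reads_crossing.
Variable p : tcpart.
Implicit Types x y z : pt p.
Notation n := (npoints p).

Lemma nth_rot_steps w x y z : size w = n ->
  nth letter0 (rot (steps x y) w) (steps y z) = nth letter0 w (steps x z).
Proof. by move=> sw; rewrite nth_rot ?sw ?steps_lt // steps_steps. Qed.

(** The four points of a crossing are met in their order when the word is read
from the first of them, so alternation of labels in one reading is alternation
up to rotation in any other. *)
Lemma reads_crossing x w (B1 B2 : {set pt p}) y1 y2 i j : reads x w ->
  B1 \in blocks p -> B2 \in blocks p -> y1 \in B1 -> y2 \in B2 ->
  (nth letter0 w (steps x y1)).1 = i -> (nth letter0 w (steps x y2)).1 = j ->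
  crossing B1 B2 <-> crosses i j (labels w).
Proof.
move=> xw hB1 hB2 hy1 hy2 e1 e2.
have m1 := reads_mem_block xw hB1 hy1 e1.
have m2 := reads_mem_block xw hB2 hy2 e2.
have sw := reads_size xw.
have lab k w' : size w' = n -> k < n ->
  nth 0 (labels w') k = (nth letter0 w' k).1.
  by move=> sw' hk; rewrite (nth_map letter0) // sw'.
split.
- case=> B12 [a1 [b1 [a2 [b2 [ha1 hb1 ha2 hb2]]]]].
  rewrite /ordered /= stepsxx andbT => /and3P [h1 h2 h3].
  have ij : i != j.
    apply: contraNneq B12 => eij; apply/eqP/setP => z.
    by rewrite m1 m2 eij.
  suff : crosses i j (labels (rot (steps x a1) w)).
    rewrite map_rot /rot => /crosses_rot.
    by rewrite cat_take_drop.
  set w' := rot _ _; have sw' : size w' = n by rewrite size_rot.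
  have nl z : nth 0 (labels w') (steps a1 z) = (nth letter0 w (steps x z)).1.
    by rewrite lab ?steps_lt // nth_rot_steps.
  have la1 : nth 0 (labels w') 0 = i.
    by have := nl a1; rewrite stepsxx => ->; apply/eqP; rewrite -m1.
  have la2 : nth 0 (labels w') (steps a1 a2) = j by apply/eqP; rewrite nl -m2.
  have lb1 : nth 0 (labels w') (steps a1 b1) = i by apply/eqP; rewrite nl -m1.
  have lb2 : nth 0 (labels w') (steps a1 b2) = j by apply/eqP; rewrite nl -m2.
  have st k l t : l <= k -> k < n -> subseq t (drop k.+1 (labels w')) ->
      subseq (nth 0 (labels w') k :: t) (drop l (labels w')).
    move=> lk kn h; have kw : k < size (labels w') by rewrite size_map sw'.
    have -> : drop l (labels w') = take (k - l) (drop l (labels w')) ++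
              nth 0 (labels w') k :: drop k.+1 (labels w').
      by rewrite -drop_nth // -{2}(subnK lk) -drop_drop cat_take_drop.
    exact: subseq_cons_cat.
  rewrite /crosses ij /=; apply/orP; left.
  have := st _ _ _ h3 (steps_lt a1 b2) (sub0seq _); rewrite lb2.
  move/(st _ _ _ h2 (steps_lt a1 b1)); rewrite lb1.
  move/(st _ _ _ h1 (steps_lt a1 a2)); rewrite la2.
  have n0 : 0 < n by apply: leq_ltn_trans (steps_lt a1 a2).
  by move/(st 0 0 _ isT n0); rewrite la1 drop0.
- move=> cr; have /andP [ij _] := cr.
  split.
    apply: contraNneq ij => B12.
    by move: hy1; rewrite B12 m2 e1.
  have [s1 [s2 [es hs]]] := crosses_head cr.
  have hk : size s1 < n.
    by rewrite -sw -(size_map fst) es size_cat /= addnS ltnS leq_addr.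
  have [a1 sa1] := steps_surj x hk.
  have nl z : nth 0 (i :: s2 ++ s1) (steps a1 z) = (nth letter0 w (steps x z)).1.
    rewrite -(nth_rot_steps x a1 z sw) -lab ?steps_lt ?size_rot // map_rot sa1 es.
    by rewrite rot_size_cat.
  have sn : size (i :: s2 ++ s1) = n.
    by rewrite -sw -(size_map fst) es !size_cat /= size_cat; lia.
  move: hs nl sn => /subseq_consE [t1 [t2 [-> /subseq_consE [t3 [t4 [->
    /subseq_consE [t5 [t6 [-> _]]]]]]]]] nl.
  rewrite /= !size_cat /= !size_cat /= size_cat /= => sn.
  have [a2 sa2] : exists z, steps a1 z = (size t1).+1 by apply: steps_surj; lia.
  have [b1 sb1] : exists z, steps a1 z = (size t1 + (size t3).+1).+1.
    by apply: steps_surj; lia.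
  have [b2 sb2] : exists z,
    steps a1 z = (size t1 + (size t3 + (size t5).+1).+1).+1.
    by apply: steps_surj; lia.
  have nthc (T : Type) (z0 : T) (u1 : seq T) u2 k :
    nth z0 (u1 ++ u2) (size u1 + k) = nth z0 u2 k.
    by rewrite nth_cat ltnNge leq_addr addKn.
  exists a1, b1, a2, b2; split.
  + by rewrite m1 -nl stepsxx.
  + by rewrite m1 -nl sb1 /= nthc /= -[size t3]addn0 nthc.
  + by rewrite m2 -nl sa2 /= -[size t1]addn0 nthc.
  + by rewrite m2 -nl sb2 /= nthc /= nthc /= -[size t5]addn0 nthc.
  + by rewrite /ordered /= stepsxx sa2 sb1 sb2; lia.
Qed.

End Reads_crossing.

Section Analyzer_words.
Variable C : set tcpart.
Hypothesis HC : category C.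
Notation W := (realizable C).

Lemma category_reads p (x : pt p) : C p -> exists2 w, W w & reads x w.
Proof.
have [u [l rp]] := exists_representation p => Cp.
have rw := reads_position x (represents_position rp).
exists (rot (position x) (l ++ reflect_word u)) => //.
have : W (l ++ reflect_word u) by apply: realizable_word => //; exists p.
rewrite -{1}(cat_take_drop (position x) (l ++ reflect_word u)).
exact: realizable_rot.
Qed.

Lemma realizable_reads w : W w -> w != [::] ->
  exists p (x : pt p), C p /\ reads x w.
Proof.
case=> p Cp rp nw; have := represents_position rp; rewrite cats0 => rw.
have h : 0 < size (lower p).
  by case: rp => _ e _; rewrite e size_map lt0n size_eq0.
exists p, (inr (Ordinal h)); split=> //.
by have := reads_position (inr (Ordinal h)) rw; rewrite /= rot0.
Qed.

(** Splitting L and K by the colors of the two legs turns gluing into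
addition: the last color of one summand must be opposite to the first of the
other. *)
Definition distances c d : set int := [set k | exists i w1 w2,
  [/\ W ((i, c) :: w1 ++ (i, d) :: w2), i \notin labels w1 &
      k = (sigma w1 + half_sum c d)%R]].

Definition cross_distances : set int := [set k | exists i j c d w1 w2,
  [/\ W ((i, c) :: w1 ++ (j, d) :: w2),
      crosses i j (labels ((i, c) :: w1 ++ (j, d) :: w2)) &
      k = (sigma w1 + half_sum c d)%R]].

Lemma Fset_words : Fset (analyzer C) =
  [set z | exists w i, [/\ W w, i \in labels w & z = (count_mem i (labels w))%:Z%R]].
Proof.
apply/seteqP; split=> z /=.
- case=> p [B [Cp hB ->]].
  have /set0Pn [x hx] : B != finset.set0.
    by case/and3P: (blocksP p) => _ _; apply: contraNneq => <-.
  have [w Ww rw] := category_reads x Cp.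
  exists w, (nth letter0 w (steps x x)).1; split => //.
    by rewrite map_f // mem_nth // (reads_size rw) steps_lt.
  by rewrite (reads_block_card rw hB hx erefl).
- case=> w [i [Ww hi ->]].
  have [p [x [Cp rw]]] : exists p (x : pt p), C p /\ reads x w.
    by apply: realizable_reads => //; case: w hi {Ww}.
  move: hi => /(nthP 0) [k]; rewrite size_map => hk e.
  have [y sy] : exists y, steps x y = k.
    by apply: steps_surj; rewrite -(reads_size rw).
  exists p, (finset.pblock (blocks p) y); split => //.
    by apply: finset.pblock_mem; apply: mem_cover_blocks.
  rewrite (@reads_block_card _ _ _ rw _ y i) //.
  - by apply: finset.pblock_mem; apply: mem_cover_blocks.
  - by rewrite finset.mem_pblock mem_cover_blocks.
  - by rewrite sy -e (nth_map letter0).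
Qed.

Lemma Vset_words : Vset (analyzer C) =
  [set z | exists w i, [/\ W w, i \in labels w & z = block_sum i w]].
Proof.
apply/seteqP; split=> z /=.
- case=> p [B [Cp hB ->]].
  have /set0Pn [x hx] : B != finset.set0.
    by case/and3P: (blocksP p) => _ _; apply: contraNneq => <-.
  have [w Ww rw] := category_reads x Cp.
  exists w, (nth letter0 w (steps x x)).1; split => //.
    by rewrite map_f // mem_nth // (reads_size rw) steps_lt.
  by rewrite (reads_block_sum rw hB hx erefl).
- case=> w [i [Ww hi ->]].
  have [p [x [Cp rw]]] : exists p (x : pt p), C p /\ reads x w.
    by apply: realizable_reads => //; case: w hi {Ww}.
  move: hi => /(nthP 0) [k]; rewrite size_map => hk e.
  have [y sy] : exists y, steps x y = k.
    by apply: steps_surj; rewrite -(reads_size rw).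
  exists p, (finset.pblock (blocks p) y); split => //.
    by apply: finset.pblock_mem; apply: mem_cover_blocks.
  rewrite (@reads_block_sum _ _ _ rw _ y i) //.
  - by apply: finset.pblock_mem; apply: mem_cover_blocks.
  - by rewrite finset.mem_pblock mem_cover_blocks.
  - by rewrite sy -e (nth_map letter0).
Qed.

Lemma realizable_nil : W [::].
Proof. exact: realizes_nil. Qed.

Lemma total_no_points p : npoints p = 0 -> total_color_sum p = 0%R.
Proof.
move=> n0; rewrite /total_color_sum /color_sum big1 // => x _.
by have := position_lt x; rewrite n0.
Qed.

Lemma Sset_words : Sset (analyzer C) = [set z | exists2 w, W w & z = sigma w].
Proof.
apply/seteqP; split=> z /=.
- case=> p Cp <-.
  have [n0|] := eqVneq (npoints p) 0.
    exists [::]; first exact: realizable_nil.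
    by rewrite total_no_points // /sigma big_nil.
  rewrite -lt0n /npoints addn_gt0 => h.
  have x : pt p.
    by case: (ltnP 0 (size (lower p))) h => [h _|_ /= h];
      [exact: inr (Ordinal h) | exact: inl (Ordinal h)].
  have [w Ww rw] := category_reads x Cp.
  by exists w => //; rewrite (reads_total rw).
- case=> w Ww ->; have [->|nw] := eqVneq w [::].
    have [p Cp [eu el _]] := realizable_nil; exists p => //.
    by rewrite total_no_points ?/sigma ?big_nil // /npoints eu el.
  have [p [x [Cp rw]]] := realizable_reads Ww nw.
  by exists p => //; rewrite (reads_total rw).
Qed.

Lemma subsequent_words p (B : {set pt p}) (x y : pt p) : C p ->
  subsequent B x y -> exists c d,
    distances c d (color_distance x y) /\
    pair_sum x y = (color_sign c + color_sign d)%R.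
Proof.
move=> Cp [hB hx hy xy h]; have [w Ww rw] := category_reads x Cp.
have [i [j [c [d [w1 [w2 [ew sy]]]]]]] := reads_split rw xy.
exists c, d; rewrite (split_distance rw ew sy) (split_pair_sum rw ew sy).
split=> //; exists i, w1, w2; split=> //.
- have := split_block rw ew sy; rewrite (same_blockP _ hB hx) hy => /esym /eqP e.
  by rewrite {2}e -ew.
- by rewrite -(split_disjoint rw ew sy hB hx) h.
Qed.

Lemma words_subsequent c d k : distances c d k ->
  exists p (B : {set pt p}) (x y : pt p),
  [/\ C p, subsequent B x y, pair_sum x y = (color_sign c + color_sign d)%R &
      k = color_distance x y].
Proof.
case=> i [w1 [w2 [Ww iw ->]]].
have [p [x [Cp rw]]] := realizable_reads Ww isT.
have [y sy] : exists y, steps x y = (size w1).+1.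
  by apply: steps_surj; rewrite -(reads_size rw) /= size_cat /=; lia.
have hB : finset.pblock (blocks p) x \in blocks p.
  by apply: finset.pblock_mem; apply: mem_cover_blocks.
have hx : x \in finset.pblock (blocks p) x by rewrite finset.mem_pblock mem_cover_blocks.
exists p, (finset.pblock (blocks p) x), x, y; split=> //.
- split=> //.
  + by have := split_block rw erefl sy; rewrite eqxx.
  + exact: (split_neq sy).
  + by apply/eqP; rewrite (split_disjoint rw erefl sy hB hx).
- exact: (split_pair_sum rw erefl sy).
- by rewrite (split_distance rw erefl sy).
Qed.

Lemma Lset_words : Lset (analyzer C) =
  [set z | exists c, distances c c z].
Proof.
apply/seteqP; split=> z /=.
- case=> p [B [x [y [Cp h nz ->]]]].
  have [c [d [hd e]]] := subsequent_words Cp h.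
  exists c; move: hd nz; rewrite e.
  by case: c d {e} => -[].
- case=> c /words_subsequent [p [B [x [y [Cp h e ->]]]]].
  by exists p, B, x, y; split=> //; rewrite e; case: (c).
Qed.

Lemma Kset_words : Kset (analyzer C) =
  [set z | exists c, distances c (opp_color c) z].
Proof.
apply/seteqP; split=> z /=.
- case=> p [B [x [y [Cp h nz ->]]]].
  have [c [d [hd e]]] := subsequent_words Cp h.
  exists c; move: hd nz; rewrite e.
  by case: c d {e} => -[].
- case=> c /words_subsequent [p [B [x [y [Cp h e ->]]]]].
  by exists p, B, x, y; split=> //; rewrite e; case: (c).
Qed.

Lemma Xset_words : Xset (analyzer C) = cross_distances.
Proof.
apply/seteqP; split=> z /=.
- case=> p [B1 [B2 [x [y [Cp [hB1 hB2] cr [hx hy] ->]]]]].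
  have xy : x != y.
    apply/eqP => e; case: cr => + _; rewrite -(finset.def_pblock (triv_blocks p) hB1 hx).
    by rewrite -(finset.def_pblock (triv_blocks p) hB2 hy) e eqxx.
  have [w Ww rw] := category_reads x Cp.
  have [i [j [c [d [w1 [w2 [ew sy]]]]]]] := reads_split rw xy.
  exists i, j, c, d, w1, w2; rewrite -ew (split_distance rw ew sy); split=> //.
  apply/(reads_crossing rw hB1 hB2 hx hy) => //.
  + by rewrite stepsxx ew.
  + by rewrite sy ew /= nth_cat ltnn subnn.
- case=> i [j [c [d [w1 [w2 [Ww cr ->]]]]]].
  have [p [x [Cp rw]]] := realizable_reads Ww isT.
  have [y sy] : exists y, steps x y = (size w1).+1.
    by apply: steps_surj; rewrite -(reads_size rw) /= size_cat /=; lia.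
  have hB t : finset.pblock (blocks p) t \in blocks p.
    by apply: finset.pblock_mem; apply: mem_cover_blocks.
  have hx t : t \in finset.pblock (blocks p) t by rewrite finset.mem_pblock mem_cover_blocks.
  exists p, (finset.pblock (blocks p) x), (finset.pblock (blocks p) y), x, y; split=> //.
  + apply/(reads_crossing rw (hB x) (hB y) (hx x) (hx y)) => //.
    by rewrite stepsxx sy /= nth_cat ltnn subnn.
  + by rewrite (split_distance rw erefl sy).
Qed.

End Analyzer_words.

(** * Gluing, folding and arithmetic of color distances *)

Lemma sigma_cat w1 w2 : sigma (w1 ++ w2) = (sigma w1 + sigma w2)%R.
Proof. exact: big_cat. Qed.

Lemma sigma_cons a w : sigma (a :: w) = (color_sign a.2 + sigma w)%R.
Proof. exact: big_cons. Qed.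

Lemma sigma_nil : sigma [::] = 0%R.
Proof. exact: big_nil. Qed.

Lemma sigma_relabel f w : sigma (relabel f w) = sigma w.
Proof. exact: big_map. Qed.

Lemma color_sign_opp c : color_sign (opp_color c) = (- color_sign c)%R.
Proof. by case: c; rewrite //= opprK. Qed.

Lemma half_sum_opp c d : half_sum (opp_color d) (opp_color c) = (- half_sum c d)%R.
Proof. by case: c d => -[]. Qed.

Lemma reflect_cat w1 w2 :
  reflect_word (w1 ++ w2) = reflect_word w2 ++ reflect_word w1.
Proof. by rewrite /reflect_word map_cat rev_cat. Qed.

Lemma reflect_cons a w : reflect_word (a :: w) = reflect_word w ++ [:: opp_letter a].
Proof. by rewrite -cat1s reflect_cat. Qed.

Lemma sigma_reflect w : sigma (reflect_word w) = (- sigma w)%R.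
Proof.
elim: w => [|a w IH]; first by rewrite sigma_nil oppr0.
rewrite reflect_cons sigma_cat IH !sigma_cons sigma_nil color_sign_opp.
by rewrite opprD addr0 addrC.
Qed.

Lemma labels_reflect w : labels (reflect_word w) = rev (labels w).
Proof. by rewrite /reflect_word map_rev -map_comp. Qed.

Lemma relabel_reflect f w : relabel f (reflect_word w) = reflect_word (relabel f w).
Proof. by rewrite /reflect_word /relabel map_rev -!map_comp. Qed.

Lemma mem_labels_reflect i w : (i \in labels (reflect_word w)) = (i \in labels w).
Proof. by rewrite labels_reflect mem_rev. Qed.

Lemma split_label i (w : word) : i \in labels w ->
  exists w1 c w2, w = w1 ++ (i, c) :: w2 /\ i \notin labels w1.
Proof.
elim: w => // -[a c] w IH; rewrite /= inE; case: eqVneq => [-> _|ia /= /IH].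
  by exists [::], c, w.
by move=> [w1 [d [w2 [-> h]]]]; exists ((a, c) :: w1), d, w2; rewrite /= inE negb_or ia.
Qed.

Lemma relabel_cons f a w : relabel f (a :: w) = (f a.1, a.2) :: relabel f w.
Proof. by []. Qed.

Section Words.
Variable C : set tcpart.
Hypothesis HC : category C.
Notation W := (realizable C).
Implicit Types w v : word.

(** A renaming that sends [j] to [i] and avoids a given list otherwise, so
that two words can be made to share just one label. *)
Lemma fresh_copy (s : seq nat) i j : exists g : nat -> nat,
  [/\ injective g, g j = i & forall x, x != j -> g x \notin i :: s].
Proof.
have [N hN] := fresh_label (i :: s).
have iN : i < N by apply: hN; rewrite inE eqxx.
exists (fun x => if x == j then i else x + N); split.
- by move=> x y; case: eqP => [->|nx]; case: eqP => [->|ny]; lia.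
- by rewrite eqxx.
- by move=> x /negbTE ->; apply/negP => /hN; lia.
Qed.

(** Rotate the second word so that it starts with the letter [j], juxtapose it
after the letter [i] at the end of a rotation of the first, and contract. *)
Lemma realizable_gluing w1 w2 v1 v2 i j c :
  W (w1 ++ (i, c) :: w2) -> W (v1 ++ (j, opp_color c) :: v2) ->
  exists g, [/\ injective g, g j = i,
    forall x, x != j -> g x \notin labels (w1 ++ (i, c) :: w2) &
    W (w1 ++ relabel g (v2 ++ v1) ++ w2)].
Proof.
move=> Ww Wv; set s := labels (w1 ++ (i, c) :: w2).
have [g [injg gj gs]] := fresh_copy s i j.
have is_ : i \in s by rewrite /s map_cat mem_cat /= inE eqxx orbT.
have gs' x : x != j -> g x \notin s.
  by move/gs; rewrite inE negb_or => /andP [].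
exists g; split=> //.
have [M hM] := fresh_label (s ++ map g (labels (v1 ++ (j, opp_color c) :: v2))).
have Ms : M \notin s.
  by apply/negP => h; have := hM M; rewrite mem_cat h ltnn => /(_ isT).
(* The auxiliary name M keeps the words disjoint until the contraction. *)
pose g' x := if x == j then M else g x.
pose f x := if x == M then i else x.
have g'M x : x \in labels (v1 ++ (j, opp_color c) :: v2) -> x != j -> g' x < M.
  move=> hx /negbTE xj; rewrite /g' xj; apply: hM.
  by rewrite mem_cat map_f ?orbT.
have g'j : g' j = M by rewrite /g' eqxx.
have {}Wv : W ((M, opp_color c) :: relabel g' (v2 ++ v1)).
  have : W (relabel g' (v1 ++ (j, opp_color c) :: v2)).
    apply: realizable_relabel => // x y hx hy.
    have [->|xj] := eqVneq x j; have [->|yj] := eqVneq y j => //.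
    - by rewrite g'j => e; have := g'M _ hy yj; rewrite -e ltnn.
    - by rewrite g'j => e; have := g'M _ hx xj; rewrite e ltnn.
    - by rewrite /g' (negbTE xj) (negbTE yj) => /injg.
  by rewrite relabel_cat => /(realizable_rot HC); rewrite /= g'j -relabel_cat.
have {}Ww : W ((w2 ++ w1) ++ [:: (i, c)]).
  by rewrite -catA; apply: realizable_rot => //; rewrite -catA.
have dis : {in labels ((w2 ++ w1) ++ [:: (i, c)])
    & labels ((M, opp_color c) :: relabel g' (v2 ++ v1)), forall a b, a != b}.
  move=> a b ha; have {}ha : a \in s.
    move: ha; rewrite /s !map_cat !mem_cat /= !inE.
    by case/orP => [/orP [] ->|->]; rewrite ?orbT.
  rewrite /= labels_relabel inE => /orP [/eqP ->|/mapP [x _ ->]].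
    by apply: contraNneq Ms => <-.
  rewrite /g'; case: (eqVneq x j) => [_|xj]; first by apply: contraNneq Ms => <-.
  by apply: contraNneq (gs' _ xj) => <-.
have := realizable_cat HC Ww Wv dis; rewrite -catA cat1s.
move/(@realizable_contraction _ HC f).
have fi : f i = i by rewrite /f; case: eqP.
have fM : f M = i by rewrite /f eqxx.
have fs w : {subset labels w <= s} -> relabel f w = w.
  move=> sw; apply: relabel_id_in => x /sw xs.
  by rewrite /f; case: eqP => // xM; rewrite xM (negbTE Ms) in xs.
rewrite fi fM [relabel f (_ ++ relabel _ _)]relabel_cat (fs (w2 ++ w1)); last first.
  move=> a; rewrite /s !map_cat !mem_cat /= !inE.
  by case/orP => ->; rewrite ?orbT.
have -> : relabel f (relabel g' (v2 ++ v1)) = relabel g (v2 ++ v1).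
  rewrite relabel_comp; apply: eq_in_relabel => x hx /=.
  have [->|xj] := eqVneq x j; first by rewrite g'j fM.
  have : g' x < M.
    apply: g'M => //; move: hx; rewrite !map_cat !mem_cat /= !inE.
    by case/orP => ->; rewrite ?orbT.
  by rewrite /f /g' (negbTE xj); case: eqP => // ->; rewrite ltnn.
move=> h; rewrite catA; apply: realizable_rot => //.
rewrite catA; apply: h => // a b _ _; rewrite /f !inE.
case: (a =P M) => [->|an]; case: (b =P M) => [->|bn] e; by [left|right; lia].
Qed.

(** Contracting [v] against a mirrored word, from the middle outwards.  The
merging [f] identifies corresponding labels and nothing else; the last clause
expresses the latter by the sets of labels that are unions of merged classes,
a form that survives the induction. *)
Lemma contract_mirror v v' w1 w2 : colors v = colors v' ->
  W (w1 ++ v ++ reflect_word v' ++ w2) ->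
  exists f, [/\ W (relabel f (w1 ++ w2)),
    map f (labels v) = map f (labels v') &
    forall P : pred nat, map P (labels v) = map P (labels v') ->
      forall a b, f a = f b -> P a = P b].
Proof.
move En : (size v) => n; elim: n v v' w1 w2 En => [|n IH] v v' w1 w2.
  move/size0nil => ->; case: v' => //= _ h.
  exists id; split=> //; first by rewrite relabel_id_in.
  by move=> P _ a b ->.
case/lastP: v => // v [x c]; rewrite size_rcons => -[sv].
case/lastP: v' => [|v' [x' c']]; first by move/(congr1 size); rewrite !size_map size_rcons.
rewrite !map_rcons => /rcons_inj /= [cv <-].
rewrite /reflect_word map_rcons rev_rcons -/(reflect_word v') /=.
rewrite -cats1 -!catA /= catA => h.
(* The innermost pair of letters is contracted first. *)
pose f1 a := if a == x' then x else a.
have f1x : f1 x = x by rewrite /f1; case: eqP.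
have f1x' : f1 x' = x by rewrite /f1 eqxx.
have := @realizable_contraction _ HC f1 _ _ _ _ _ h.
rewrite f1x f1x' => /(_ erefl) {}h.
have {h} : W (relabel f1 ((w1 ++ v) ++ reflect_word v' ++ w2)).
  apply: h => a b _ _; rewrite /f1 !inE.
  by case: (a =P x') => [->|an]; case: (b =P x') => [->|bn] e; by [left|right; lia].
rewrite -catA !relabel_cat relabel_reflect => /IH.
rewrite size_relabel !colors_relabel => /(_ sv cv) [f [Wf fv fP]].
exists (f \o f1); split.
- by rewrite -relabel_comp relabel_cat.
- move: fv; rewrite !labels_relabel !map_rcons -!map_comp /= f1x f1x' => fv.
  by congr rcons.
- move=> P; rewrite !map_rcons => /rcons_inj [Pv Pxx'] a b /= e.
  have Pf1 z : P (f1 z) = P z by rewrite /f1; case: eqP => // ->.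
  have := fP P _ _ _ e; rewrite !Pf1; apply.
  have mP l : map P (map f1 l) = map P l.
    by rewrite -map_comp; apply: eq_map => z; apply: Pf1.
  by rewrite !labels_relabel !mP.
Qed.

Lemma realizable_mirror_copy w : W w -> exists g,
  [/\ injective g, forall x, g x \notin labels w &
      W (w ++ reflect_word (relabel g w))].
Proof.
move=> Ww; have [N hN] := fresh_label (labels w).
have gw x : N + x \notin labels w by apply/negP => /hN; lia.
exists (addn N); split => //; first exact: addnI.
apply: realizable_cat => //.
  by apply: realizable_reflect => //; apply: realizable_relabel => // x y _ _ /addnI.
move=> a b ha; rewrite mem_labels_reflect labels_relabel => /mapP [x _ ->].
by apply: contraNneq (gw x) => <-.
Qed.

(** Juxtapose a mirrored copy and contract the two copies of [v].  A block of
[u] merges with its copy exactly when it reaches into [v], and the two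
conclusions record this. *)
Lemma realizable_fold u v : W (u ++ v) -> exists f g,
  [/\ W (relabel f u ++ reflect_word (relabel (f \o g) u)),
    {in labels v, forall i, f (g i) = f i} &
    {in labels u, forall i, i \notin labels v -> f (g i) <> f i}].
Proof.
move=> h; have [g [injg gw]] := realizable_mirror_copy h.
rewrite relabel_cat reflect_cat -catA.
case/contract_mirror; first by rewrite colors_relabel.
move=> f [Wf fv fP]; exists f, g; split.
- by move: Wf; rewrite relabel_cat relabel_reflect relabel_comp.
- move=> i iv; move: fv; rewrite labels_relabel -(map_comp f g) => /eq_in_map.
  by move/(_ i iv) => /= ->.
- move=> i iu iv e; have := fP (pred1 i) _ _ _ e; rewrite /= eqxx.
  rewrite labels_relabel -(map_comp (pred1 i) g).
  have -> : (g i == i) = false.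
    by apply: contraNF (gw i) => /eqP ->; rewrite map_cat mem_cat iu.
  suff -> : map (pred1 i) (labels v) = map (pred1 i \o g) (labels v) by move/(_ erefl).
  apply/eq_in_map => x xv /=.
  have -> : (x == i) = false by apply: contraNF iv => /eqP <-.
  apply/esym/negbTE; apply: contraNneq (gw x) => ->.
  by rewrite map_cat mem_cat iu.
Qed.

Definition word_s : word := [:: (0, White); (1, Black)].
Definition word_f : word := [:: (0, White); (0, Black); (0, White); (0, Black)].

Lemma realizable_part p w : represents p [::] w -> W w -> C p.
Proof. by move=> rp [q Cq rq]; rewrite (represents_inj rp rq). Qed.

Lemma part_sE : C part_s <-> W word_s.
Proof.
have rs := @represents_singletons White Black 0 1 isT.
by split=> [Cs|]; [exists part_s | exact: realizable_part].
Qed.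

Lemma part_fE : C part_f <-> W word_f.
Proof.
have rf := represents_one_block [::] [:: White; Black; White; Black] 0.
by split=> [Cf|]; [exists part_f | exact: realizable_part].
Qed.

(** Folding away everything except the singleton leaves the singleton and its
mirror image, which stay separate. *)
Lemma singleton_word_s i c w : W ((i, c) :: w) -> i \notin labels w -> W word_s.
Proof.
rewrite -cat1s => /realizable_fold [f [g [Wf _ /(_ i)]]].
rewrite /= inE eqxx => /(_ isT) h /h {h} fgi.
have {}Wf : W [:: (f i, c); (f (g i), opp_color c)] by [].
suff [a [b [ab]]] : exists a b, a <> b /\ W [:: (a, White); (b, Black)].
  move/(@realizable_relabel _ (fun x => if x == a then 0 else 1)).
  rewrite /= eqxx; have -> : (b == a) = false by apply/eqP => /esym.
  apply=> x y; rewrite !inE => /orP [] /eqP -> /orP [] /eqP ->;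
  by rewrite ?eqxx //; have -> : (b == a) = false by apply/eqP => /esym.
case: c Wf => Wf; first by exists (f i), (f (g i)); split=> // /esym.
exists (f (g i)), (f i); split=> //.
exact: (realizable_rot HC (w1 := [:: _])) Wf.
Qed.

(** A mirrored segment can be contracted at the price of some merging of
blocks, which leaves equal labels equal. *)
Lemma realizable_erase x y w1 w2 : colors x = colors y ->
  W (w1 ++ x ++ reflect_word y ++ w2) -> exists f, W (relabel f (w1 ++ w2)).
Proof. by move=> h /contract_mirror [//|f [Wf _ _]]; exists f. Qed.

(** Write the word as [a w b v] with the block of [a] and [b] reaching into
[v].  Folding away [v] connects [a], [b] and their mirror images: [a w b b* w*
a*].  Rotating to [a* a w] followed by [b b* w*] and folding away the second
part gives [a* a w w* a* a], again with the four points in one block, and then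
[w w*] contracts. *)
Lemma triple_word_f i c1 c2 w v : W ((i, c1) :: w ++ (i, c2) :: v) ->
  i \in labels v -> W word_f.
Proof.
have -> : (i, c1) :: w ++ (i, c2) :: v = ((i, c1) :: w ++ [:: (i, c2)]) ++ v.
  by rewrite /= -catA.
move=> /realizable_fold [f [g [Wf fgv _]]] iv.
move: Wf; rewrite !relabel_cons !relabel_cat reflect_cons reflect_cat /=.
rewrite fgv //; set k := f i; rewrite -!catA /=.
set y := reflect_word _.
have -> : (k, c1) :: relabel f w ++ [:: (k, c2), opp_letter (k, c2)
      & y ++ [:: opp_letter (k, c1)]] =
    ((k, c1) :: relabel f w ++ [:: (k, c2), opp_letter (k, c2) & y]) ++
    [:: opp_letter (k, c1)] by rewrite /= -catA.
move/(realizable_rot HC) => h.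
have {h} : W ((opp_letter (k, c1) :: (k, c1) :: relabel f w) ++
  (k, c2) :: opp_letter (k, c2) :: y) by [].
case/realizable_fold => f' [g' [+ fg' _]].
have {}fg' : f' (g' k) = f' k by apply: fg'; rewrite /= inE eqxx.
rewrite !relabel_cons !reflect_cons /opp_letter /= fg' opp_colorK -!catA; set m := f' k.
move/(@realizable_erase _ _ [:: _; _]).
case=> [|h /=]; first by rewrite !colors_relabel.
set n := h m => Wf.
have {}Wf d : W [:: (n, d); (n, opp_color d); (n, d); (n, opp_color d)].
  have [->|] := eqVneq d (opp_color c1); first by rewrite opp_colorK.
  move=> dc; have -> : d = c1 by case: d c1 dc {Wf} => -[].
  exact: (realizable_rot HC (w1 := [:: _])) Wf.
apply: (@realizable_relabel _ (fun=> 0) _ _ (Wf White)) => a b.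
by rewrite !inE !orbb => /eqP -> /eqP ->.
Qed.

(** Gluing [s] to a letter replaces it by a singleton of the same color. *)
Lemma realizable_detach w1 w2 i c : W word_s -> W (w1 ++ (i, c) :: w2) ->
  exists2 n, n \notin labels (w1 ++ (i, c) :: w2) & W (w1 ++ (n, c) :: w2).
Proof.
move=> Ws Ww.
have [j [k [jk Wjk]]] : exists j k, j <> k /\ W [:: (j, opp_color c); (k, c)].
  case: c {Ww}; [exists 1, 0 | exists 0, 1]; split=> //.
  exact: (realizable_rot HC (w1 := [:: _])) Ws.
have [g [_ _ gs Wg]] := realizable_gluing (v1 := [::]) Ww Wjk.
by exists (g k) => //; apply: gs; apply/eqP => /esym.
Qed.

Local Open Scope ring_scope.

Lemma distances_pair c : distances C c (opp_color c) 0.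
Proof.
exists 0%N, [::], [::]; split=> //; first exact: realizable_pair.
by rewrite sigma_nil; case: (c).
Qed.

Lemma distances_opp c d k : distances C c d k ->
  distances C (opp_color d) (opp_color c) (- k).
Proof.
case=> i [w1 [w2 [Ww iw ->]]].
exists i, (reflect_word w1), (reflect_word w2); split.
- move: Ww; rewrite -cat_cons => /(realizable_reflect HC).
  rewrite reflect_cat !reflect_cons -!catA => /(realizable_rot HC).
  by rewrite -!catA.
- by rewrite mem_labels_reflect.
- by rewrite sigma_reflect half_sum_opp opprD.
Qed.

Lemma relabel_notin g i j w : injective g -> g j = i -> j \notin labels w ->
  i \notin labels (relabel g w).
Proof. by move=> injg <- h; rewrite labels_relabel mem_map. Qed.

Lemma half_sum_glue c d e :
  half_sum c d + half_sum (opp_color d) e = half_sum c e.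
Proof. by case: c d e => -[] []. Qed.

(** Glue the second leg of the first word to the first leg of the second word;
the outer legs become subsequent. *)
Lemma distances_add c d e k l : distances C c d k ->
  distances C (opp_color d) e l -> distances C c e (k + l).
Proof.
case=> i [w1 [w2 [Ww iw ->]]] [j [v1 [v2 [Wv jv ->]]]].
move: Ww; rewrite -cat_cons => Ww.
have [g [injg gj gs Wg]] := realizable_gluing (v1 := [::]) Ww Wv.
move: Wg; rewrite cats0 relabel_cat relabel_cons /= gj -catA /= catA => Wg.
exists i, (w1 ++ relabel g v1), (relabel g v2 ++ w2); split=> //.
- by rewrite map_cat mem_cat negb_or iw (relabel_notin injg gj jv).
- rewrite sigma_cat sigma_relabel -(half_sum_glue c d e); ring.
Qed.

(** Insert [w] into a pair. *)
Lemma distances_total w c : W w -> distances C c (opp_color c) (sigma w).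
Proof.
move=> Ww; have [n hn] := fresh_label (labels w).
exists n, w, [::]; split; last by case: (c); rewrite /half_sum /= addr0.
- have h : W ([:: (n, opp_color c); (n, c)] ++ w).
    apply: realizable_cat => //.
      by have := realizable_pair HC n (opp_color c); rewrite opp_colorK.
    move=> a b; rewrite /= !inE orbb => /eqP -> hb.
    by apply: contraNneq (notin_fresh hn) => ->.
  exact: (realizable_rot HC (w1 := [:: _])) h.
- exact: notin_fresh.
Qed.

Lemma half_sum_total c d :
  color_sign c + color_sign d = half_sum c d + half_sum d c :> int.
Proof. by case: c d => -[]. Qed.

(** In a block of two points the other arc is free of the block as well, and
both distances add up to the total color sum. *)
Lemma distances_complement c d k :
  (forall w, W w -> forall i, (count_mem i (labels w) <= 2)%N) ->
  distances C c d k -> exists2 w, W w & distances C d c (sigma w - k).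
Proof.
move=> short [i [w1 [w2 [Ww iw ->]]]].
exists ((i, c) :: w1 ++ (i, d) :: w2) => //.
exists i, w2, w1; split.
- by move: Ww; rewrite -cat_cons => /(realizable_rot HC).
- have := short _ Ww i; rewrite /= map_cat count_cat /= !eqxx.
  rewrite -has_pred1 has_count; move: (count _ _) (count _ _) => a b; lia.
- rewrite !sigma_cons sigma_cat sigma_cons /= .
  have := half_sum_total c d; lia.
Qed.

Lemma crosses_rev i j (s : seq nat) : crosses i j (rev s) = crosses i j s.
Proof.
rewrite /crosses orbC; congr (_ && (_ || _)).
  by rewrite -[RHS]subseq_rev.
by rewrite -[RHS]subseq_rev.
Qed.

Lemma cross_distances_opp k : cross_distances C k -> cross_distances C (- k).
Proof.
case=> i [j [c [d [w1 [w2 [Ww cr ->]]]]]].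
have e : reflect_word ((i, c) :: w1 ++ [:: (j, d)]) ++ reflect_word w2 =
    (j, opp_color d) :: reflect_word w1 ++ (i, opp_color c) :: reflect_word w2.
  by rewrite reflect_cons reflect_cat -!catA.
have f : (i, c) :: w1 ++ (j, d) :: w2 = ((i, c) :: w1 ++ [:: (j, d)]) ++ w2.
  by rewrite /= -catA.
exists j, i, (opp_color d), (opp_color c), (reflect_word w1), (reflect_word w2).
rewrite -e sigma_reflect half_sum_opp opprD; split=> //.
  by apply: realizable_rot => //; rewrite -reflect_cat -f; apply: realizable_reflect.
rewrite map_cat; apply: crosses_rot.
by rewrite -map_cat -reflect_cat -f labels_reflect crosses_rev crosses_sym.
Qed.

Lemma crosses_subseq i j (s t : seq nat) : subseq s t -> crosses i j s -> crosses i j t.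
Proof.
move=> st /andP [ij /orP h]; rewrite /crosses ij /=; apply/orP.
by case: h => h; [left|right]; apply: subseq_trans h st.
Qed.

(** Glue the first leg of a block to the second crossing point: its next leg
takes over the place of this point in the cyclic order, so the crossing
persists, and the distance grows by [l]. *)
Lemma cross_distances_add k l : cross_distances C k ->
  (forall d, exists e, distances C d e l) -> cross_distances C (k + l).
Proof.
case=> i [j [c [d [w1 [w2 [Ww cr ->]]]]]] /(_ (opp_color d)).
case=> e [n [v1 [v2 [Wv nv ->]]]].
move: (Ww); rewrite -cat_cons => Ww'.
have [g [injg gn gs Wg]] := realizable_gluing (v1 := [::]) Ww' Wv.
move: Wg; rewrite cats0 relabel_cat relabel_cons /= gn -catA /= catA => Wg.
exists i, j, c, e, (w1 ++ relabel g v1), (relabel g v2 ++ w2); split=> //.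
- apply: crosses_subseq cr.
  rewrite /= eqxx !map_cat /= !map_cat -catA.
  apply: cat_subseq => //; apply: (@cat_subseq _ [::]); first exact: sub0seq.
  by rewrite /= eqxx; apply: suffix_subseq.
- rewrite sigma_cat sigma_relabel -(half_sum_glue c d e); ring.
Qed.

End Words.

(** * Subgroups and complements of symmetric periodic sets *)

Local Open Scope ring_scope.

Lemma mulZE (m k : int) : mulZ m k <-> (m %| k)%Z.
Proof.
split=> [[z _ <-]|/dvdzP [z ->]]; first by rewrite dvdz_mulr.
by exists z => //; rewrite mulrC.
Qed.

Lemma subgroup_mulZ (A : set int) : A 0 -> (forall x y, A x -> A y -> A (x - y)) ->
  exists m : nat, A = mulZ m%:Z.
Proof.
move=> A0 AB; have AN x : A x -> A (- x) by rewrite -[- x]add0r; apply: AB.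
have AD x y : A x -> A y -> A (x + y).
  by move=> hx /AN hy; rewrite -[y]opprK; apply: AB.
have An x (n : nat) : A x -> A (x *+ n).
  by move=> Ax; elim: n => [|n IH]; rewrite ?mulr0n // mulrS; apply: AD.
have AM x z : A x -> A (z * x).
  case: z => n Ax; first by have := An _ n Ax; rewrite -mulr_natl natz.
  by have := AN _ (An _ n.+1 Ax); rewrite -mulr_natl natz -mulNr NegzE.
pose Q := [pred n : nat | (0 < n)%N && `[< A n%:Z >]].
have [[n0 hn0]|hQ] := pselect (exists n, Q n); last first.
  exists 0%N; apply/seteqP; split=> x; rewrite mulZE dvd0z; last by move/eqP ->.
  move=> Ax; apply/negP => /negP x0; apply: hQ; exists `|x|%N.
  rewrite /= absz_gt0 x0 /=; apply/asboolP.
  by have [h|h] := lerP 0 x; [rewrite gez0_abs | rewrite ltz0_abs //; apply: AN].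
have exQ : exists n, Q n by exists n0.
case: (ex_minnP exQ) => m /andP [m0 /asboolP Am] minm.
exists m; apply/seteqP; split=> x; rewrite mulZE; last first.
  by move/dvdzP => [z ->]; apply: AM.
move=> Ax; have mz : m%:Z != 0 by lia.
have Ar : A (x %% m)%Z by rewrite /modz; apply: AB => //; apply: AM.
apply/dvdz_mod0P.
have r0 := modz_ge0 x mz; have rm := ltz_pmod x (m0 : 0 < m%:Z).
case e : (x %% m)%Z r0 rm Ar => [r|//] _ rm Ar.
case: r e rm Ar => // r e rm Ar.
have := minm r.+1; rewrite /= => h.
have : (m <= r.+1)%N by apply: h; apply/asboolP.
lia.
Qed.

Section Complement.
Variable X : set int.
Hypothesis XN : forall z, X z -> X (- z).

Lemma complement_sub_0 (E := [set z | 0 <= z /\ ~ X z]) : X = setT `\` sub_m E 0.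
Proof.
have XNE z : X (- z) <-> X z by split=> /XN; rewrite ?opprK.
apply/seteqP; split=> z.
- move=> Xz; split=> // -[a Ea [b _]]; rewrite mul1r mul0r addr0 => az.
  case: Ea => [[_]|[b' [_ hb']]]; first by rewrite az.
  by rewrite add0r mulN1r => e; apply: hb'; apply/XNE; rewrite e az.
- case=> _ h; apply: contrapT => nXz; apply: h.
  exists z; last by exists 0 => //; rewrite mul1r mul0r addr0.
  have [z0|z0] := lerP 0 z; [by left | right].
  exists (- z); last by rewrite add0r mulN1r opprK.
  by split; [lia | move/XNE].
Qed.

(** A symmetric [m]-periodic set is determined by its elements between 0 and
half of [m]. *)
Lemma complement_sub_m (m : nat) : (0 < m)%N -> (forall z t, X z -> X (z + m%:Z * t)) ->
  let D := [set z | 0 <= z <= (m %/ 2)%:Z /\ ~ X z] in X = setT `\` sub_m D m.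
Proof.
move=> m0 XM D; have XNE z : X (- z) <-> X z by split=> /XN; rewrite ?opprK.
have XME z t : X (z + m%:Z * t) <-> X z.
  by split=> h; [have := XM _ (- t) h; rewrite mulrN addrK | exact: XM].
apply/seteqP; split=> z.
- move=> Xz; split=> // -[a Ea [t _]]; rewrite mul1r => az.
  suff : ~ X a by apply; apply/(XME _ t); rewrite az.
  case: Ea => [[_]|[b [_ hb] <-]] //.
  move=> h; apply: hb; apply/XNE; apply/(XME _ 1); rewrite mulr1 addrC.
  by move: h; rewrite mulN1r.
- case=> _ h; apply: contrapT => nXz; apply: h.
  have mz : m%:Z != 0 by lia.
  have r0 := modz_ge0 z mz; have rm := ltz_pmod z (m0 : 0 < m%:Z).
  have zE := divz_eq z m.
  set r := (z %% m)%Z in r0 rm zE; set q := (z %/ m)%Z in zE.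
  have nXr : ~ X r by move/(XME _ q); rewrite addrC mulrC -zE.
  exists r; last by exists q => //; rewrite mul1r addrC mulrC -zE.
  have [rh|rh] := lerP r (m %/ 2)%:Z; first by left; split=> //; rewrite r0.
  right; exists (m%:Z - r); last by rewrite mulN1r opprB addrCA subrr addr0.
  split; first lia.
  by move=> h; apply: nXr; apply/XNE; apply/(XME _ 1); rewrite mulr1 addrC.
Qed.

End Complement.

Section Shape.
Variable C : set tcpart.
Hypothesis HC : category C.
Notation W := (realizable C).
Notation dist := (distances C).

Definition short_blocks :=
  forall w, W w -> forall i, (count_mem i (labels w) <= 2)%N.

Lemma distances_subgroup c : exists m : nat, dist c (opp_color c) = mulZ m%:Z.
Proof.
apply: subgroup_mulZ; first exact: distances_pair.
move=> x y hx /(distances_opp HC); rewrite opp_colorK => hy.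
by apply: distances_add hx _ => //; rewrite opp_colorK.
Qed.

Lemma sigma_dist w c : W w -> dist c (opp_color c) (sigma w).
Proof. exact: distances_total. Qed.

Lemma distances_like_opp c k : dist c c k -> dist (opp_color c) (opp_color c) (- k).
Proof. exact: distances_opp. Qed.

(** The two orders of opposite colors give subgroups.  They agree because of
the complementary arc in a block of two points, or because each is obtained
from the other by passing through a leg of equal color. *)
Lemma distances_unlike_subgroup : short_blocks \/ dist White White !=set0 ->
  exists m : nat, forall c, dist c (opp_color c) = mulZ m%:Z.
Proof.
move=> hyp; suff sw c k : dist c (opp_color c) k -> dist (opp_color c) c k.
  have [m em] := distances_subgroup White; exists m; case=> //.
  by rewrite -em; apply/seteqP; split=> k; [apply: (sw Black) | apply: (sw White)].
case: hyp => [short|[l hl]].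
- move=> /(distances_complement HC short) [w /sigma_dist Ww h].
  have [m em] := distances_subgroup (opp_color c).
  move: h (Ww (opp_color c)); rewrite opp_colorK in em *; rewrite em.
  rewrite !mulZE => h1 h2.
  by have := rpredB h2 h1; rewrite opprB addrC subrK.
- have [l' hl'] : exists l', dist c c l'.
    by case: (c); [exists l | exists (- l); apply: (@distances_like_opp White)].
  move=> hk; have h1 := distances_add HC hk; rewrite opp_colorK in h1.
  have := distances_add HC (distances_like_opp hl'); rewrite opp_colorK.
  by move/(_ _ _ (h1 _ _ hl')); rewrite [k + _]addrC addKr.
Qed.

(** Differences of distances of equally colored legs are distances of
oppositely colored ones, hence a coset; the complementary arc, or the element
0, makes it symmetric. *)
Lemma distances_like_coset (m : nat) : short_blocks \/ dist White White 0 ->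
  (forall c, dist c (opp_color c) = mulZ m%:Z) ->
  (forall c, dist c c = set0) \/
  exists2 l, mulZ m%:Z (l + l) & forall c, dist c c = shift_set l m%:Z setT.
Proof.
move=> hyp hm.
have coset c l : dist c c l -> dist c c = shift_set l m%:Z setT.
  move=> hl; apply/seteqP; split=> k.
    move=> hk; have := distances_add HC hk (distances_like_opp hl).
    rewrite hm => -[z _ e]; exists z => //; rewrite e; ring.
  case=> z _ <-; rewrite addrC; apply: (distances_add HC (d := opp_color c)).
    by rewrite hm; exists z.
  by rewrite opp_colorK.
have [[l hl]|nl] := pselect (exists l, dist White White l); last first.
  left; case; apply/seteqP; split=> // k hk; apply: nl; first by exists k.
  by exists (- k); apply: (@distances_like_opp Black).
right.
have [l0 h0 h2] : exists2 l, dist White White l & mulZ m%:Z (l + l).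
  case: hyp => [short|h0]; last first.
    by exists 0 => //; exists 0 => //; rewrite mulr0 addr0.
  exists l => //.
  have [w /(@sigma_dist _ White) hs] := distances_complement HC short hl.
  move/distances_like_opp/(distances_add HC hl).
  move: hs; rewrite !hm !mulZE => hs h.
  have -> : l + l = sigma w + (l + - (sigma w - l)) by ring.
  exact: rpredD.
exists l0 => //; case; first exact: coset.
have -> : shift_set l0 m%:Z setT = shift_set (- l0) m%:Z setT.
  case: h2 => z _ e; apply/seteqP; split=> k [t _ <-].
    exists (t + z) => //; rewrite mulrDr e; ring.
  exists (t - z) => //; rewrite mulrBr e; ring.
by apply: coset; apply: (@distances_like_opp White).
Qed.

End Shape.

(** * Levels and the parity argument *)

Lemma odd_count (T : eqType) (s : seq T) :
  odd (size s) -> exists x, odd (count_mem x s).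
Proof.
have [n] := ubnP (size s); elim: n s => // n IH [//|a s] /ltnSE hs os.
have [h|h] := boolP (odd (count_mem a (a :: s))); first by exists a.
have e : (count_mem a (a :: s) + count (predC1 a) (a :: s) = size (a :: s))%N.
  exact: count_predC.
have ha : (0 < count_mem a (a :: s))%N by rewrite /= eqxx.
have [x hx] : exists x, odd (count_mem x (filter (predC1 a) (a :: s))).
  apply: IH; rewrite size_filter.
    apply: leq_trans hs; rewrite -[X in (_ < X)%N]/(size (a :: s)) -e.
    by rewrite -[X in (X < _)%N]add0n ltn_add2r.
  by move: os; rewrite -e oddD (negbTE h).
exists x; move: hx; rewrite count_filter.
have [->|xa] := eqVneq x a.
  rewrite (eq_count (a2 := pred0)) ?count_pred0 // => y /=.
  by case: eqVneq.
rewrite (eq_count (a2 := pred1 x)) // => y /=.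
by case: (eqVneq y x) => // ->; rewrite xa.
Qed.

(** A white letter climbs from its level to the next height, a black one
descends to its level: the level is the lower of the two heights. *)
Definition level_offset (c : color) : int := if c is White then 0 else -1.

Fixpoint levels (h : int) (w : word) : seq (nat * int) :=
  if w is a :: w' then
    (a.1, h + level_offset a.2) :: levels (h + color_sign a.2) w'
  else [::].

Lemma levels_cat h w1 w2 :
  levels h (w1 ++ w2) = levels h w1 ++ levels (h + sigma w1) w2.
Proof.
elim: w1 h => [|a w1 IH] h /=; first by rewrite sigma_nil addr0.
by rewrite IH sigma_cons addrA.
Qed.

Lemma labels_levels h w : [seq a.1 | a <- levels h w] = labels w.
Proof. by elim: w h => //= a w IH h; rewrite IH. Qed.

(** With this convention the color distance of two letters is the difference
of their levels. *)
Lemma half_sum_level c d : half_sum c d = color_sign c - level_offset c + level_offset d.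
Proof. by case: c d => -[]. Qed.

Section Parity.
Variables (P : pred int) (phi : int -> bool).
Hypothesis phiP : forall h, phi (h + 1) = phi h (+) P h.

(** Each letter whose level satisfies [P] flips [phi], so [phi] at both ends
determines the parity of their number. *)
Lemma odd_levels h w :
  odd (count (fun a => P a.2) (levels h w)) = phi h (+) phi (h + sigma w).
Proof.
elim: w h => [|[i c] w IH] h /=; first by rewrite sigma_nil addr0 addbb.
rewrite oddD IH sigma_cons oddb addrA; case: c => /=.
  by rewrite addr0 phiP; case: (P h); case: (phi h); case: (phi (h + 1 + _)).
have := phiP (h - 1); rewrite subrK => ->.
by case: (P _); case: (phi (h - 1)); case: (phi _).
Qed.

End Parity.

Definition residue_class (m : nat) (r : int) : pred int := fun h => (m %| h - r)%Z.

Lemma odd_absD (x y : int) : odd `|(x + y)%R|%N = odd `|x|%N (+) odd `|y|%N.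
Proof. lia. Qed.

(** For positive [m], [phi] is the parity of the number of multiples crossed,
for [m = 0] it tells on which side of [r] the height lies. *)
Lemma residue_class_parity (m : nat) r : exists phi : int -> bool,
  [/\ forall h, phi (h + 1) = phi h (+) residue_class m r h,
      (0 < m)%N -> forall h q, phi (h + m%:Z * q) = phi h (+) odd `|q|%N &
      m = 0%N -> forall h, phi h = (r < h)].
Proof.
case: m => [|n].
  exists (fun h => r < h); split=> // h; rewrite /residue_class dvd0z; lia.
set m := n.+1; have m0 : m%:Z != 0 by [].
exists (fun h => odd `|((h - r - 1) %/ m%:Z)%Z|%N); split=> // [h|_ h q]; last first.
  have -> : h + m%:Z * q - r - 1 = q * m%:Z + (h - r - 1) by ring.
  by rewrite divzMDl // odd_absD addbC.
have -> : h + 1 - r - 1 = h - r by ring.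
rewrite /residue_class; set x := h - r.
have r0 := modz_ge0 (x - 1) m0; have rm := ltz_pmod (x - 1) (isT : 0 < m%:Z).
have e := divz_eq (x - 1) m%:Z.
set q := ((x - 1) %/ m)%Z in e *; set t := ((x - 1) %% m)%Z in r0 rm e.
have [tm|tm] := eqVneq (t + 1) m%:Z.
  have -> : x = (q + 1) * m%:Z by rewrite mulrDl mul1r -[X in _ + X]tm addrA -e subrK.
  by rewrite mulzK // odd_absD dvdz_mull.
have xE : x = q * m%:Z + (t + 1) by rewrite addrA -e subrK.
have t1 : 0 <= t + 1 < `|m%:Z| by lia.
have -> : (x %/ m%:Z)%Z = q by rewrite xE divzMDl // divz_small // addr0.
suff -> : (m%:Z %| x)%Z = false by rewrite addbF.
apply/negP => /dvdz_mod0P; rewrite xE modzMDl modz_small //; lia.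
Qed.

Section Pairing.
Variable C : set tcpart.
Hypothesis HC : category C.
Notation W := (realizable C).
Notation dist := (distances C).
Variable m : nat.
Hypothesis pairing : forall w, W w -> {in labels w, forall i, count_mem i (labels w) = 2}.
Hypothesis dist_m : forall c d k, dist c d k -> (m %| k)%Z.

Lemma residue_class_shift r h k : (m %| k)%Z -> residue_class m r (h + k) = residue_class m r h.
Proof. by move=> mk; rewrite /residue_class addrAC rpredDr. Qed.

Definition in_residue_class r i (a : nat * int) := (a.1 == i) && residue_class m r a.2.

Lemma in_residue_class_notin r i h w : i \notin labels w -> count (in_residue_class r i) (levels h w) = 0%N.
Proof.
rewrite -(labels_levels h) => iw; apply/eqP; rewrite -leqn0 leqNgt -has_count.
apply: contra iw => /hasP [a ha /andP [/eqP <- _]].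
exact: map_f.
Qed.

(** Both ends of a strand are in the class or none is.  Strands with both ends
in [w] thus contribute an even number, and an odd number requires a strand
with a single end in [w]. *)
Lemma leaving_strand r h w0 w w3 : W (w0 ++ w ++ w3) ->
  odd (count (fun a => residue_class m r a.2) (levels h w)) ->
  exists w1 i c w2, [/\ w = w1 ++ (i, c) :: w2, i \notin labels w1,
    i \notin labels w2 & residue_class m r (h + sigma w1 + level_offset c)].
Proof.
move=> Ww; rewrite -size_filter -(size_map fst) => /odd_count [i].
rewrite count_map count_filter.
rewrite (eq_count (a2 := in_residue_class r i)) // => hi.
have iw : i \in labels w.
  by apply: contraLR hi => iw; rewrite in_residue_class_notin.
have [w1 [c [w2 [wE iw1]]]] := split_label iw.
exists w1, i, c, w2; move: hi; rewrite wE levels_cat count_cat in_residue_class_notin //=.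
have := pairing Ww (x := i); rewrite wE !map_cat /= !mem_cat inE eqxx !orbT.
rewrite !count_cat /= !eqxx => /(_ isT) c2.
rewrite {1}/in_residue_class /= eqxx /=.
have [iw2|iw2] := boolP (i \in labels w2); last first.
  by rewrite in_residue_class_notin // addn0 oddb.
have [w4 [d [w5 [w2E iw4]]]] := split_label iw2.
have iw5 : i \notin labels w5.
  move: c2; rewrite w2E map_cat count_cat /= eqxx -has_pred1 has_count.
  move: (count _ (labels w5)); lia.
rewrite w2E levels_cat count_cat in_residue_class_notin //= in_residue_class_notin // addn0 add0n.
rewrite {1}/in_residue_class /= eqxx /=.
have : dist c d (sigma w4 + half_sum c d).
  exists i, w4, (w5 ++ w3 ++ w0 ++ w1); split=> //.
  move: Ww; rewrite wE w2E -!catA catA => /(realizable_rot HC).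
  by rewrite /= -!catA /= -?catA.
move/dist_m/(residue_class_shift r (h + sigma w1 + level_offset c)).
have -> : h + sigma w1 + level_offset c + (sigma w4 + half_sum c d) =
  h + sigma w1 + color_sign c + sigma w4 + level_offset d.
  by rewrite half_sum_level; ring.
by move=> ->; case: (residue_class _ _ _).
Qed.

(** The height after a first letter at level 0. *)
Definition start_height c : int := color_sign c - level_offset c.

(** The leaving strand [k] separates the circle into two arcs, one holding the
letter [i] and the other the letter [j].  If [i = j] is a strand, it is cut.
If [i] and [j] are crossing strands and [k] crossed neither, they would lie in
different arcs and could not cross.  The condition on [y] in this second
alternative prevents [k] from being [i] or [j]. *)
Lemma cross_of_odd r i j c d w v : W ((i, c) :: w ++ (j, d) :: v) ->
  let z := sigma w + half_sum c d in
  odd (count (fun a => residue_class m r a.2) (levels (start_height c) w)) ->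
  (i = j /\ i \notin labels w) \/
  (crosses i j (labels ((i, c) :: w ++ (j, d) :: v)) /\
     forall y, residue_class m r y -> ~~ (m %| y)%Z /\ ~~ (m %| z - y)%Z) ->
  exists2 y, residue_class m r y & cross_distances C y \/ i <> j /\ cross_distances C (z - y).
Proof.
move=> Ww z; have Ww' : W ([:: (i, c)] ++ w ++ (j, d) :: v) by [].
case/(leaving_strand Ww') => w1 [k [e [w2 [wE kw1 kw2 hk]]]] hyp.
set y := sigma w1 + half_sum c e.
have yk : residue_class m r y.
  by rewrite /y half_sum_level -/(start_height c) addrA [sigma w1 + _]addrC.
have zy : z - y = sigma w2 + half_sum e d.
  rewrite /z /y wE sigma_cat sigma_cons !half_sum_level /=; ring.
exists y => //.
have Wk : W ((k, e) :: w2 ++ (j, d) :: v ++ (i, c) :: w1).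
  have : W (((i, c) :: w1) ++ (k, e) :: w2 ++ (j, d) :: v).
    by move: Ww; rewrite wE /= -catA.
  by move/(realizable_rot HC); rewrite /= -catA.
have ki : k <> i.
  case: hyp => [[_ iw] ki|[_ /(_ _ yk) [nd _]] ki].
    by move: iw; rewrite wE map_cat mem_cat /= inE -ki eqxx orbT.
  suff /dist_m : dist c e y by rewrite (negbTE nd).
  exists i, w1, (w2 ++ (j, d) :: v); split=> //; last by rewrite -ki.
  by move: Ww; rewrite wE -ki /= -catA.
have kj : k <> j.
  case: hyp => [[<- _] //|[_ /(_ _ yk) [_ nd]] kj].
  suff /dist_m : dist e d (z - y) by rewrite (negbTE nd).
  exists k, w2, (v ++ (i, c) :: w1); split=> //.
  by rewrite {2}kj.
have kv : k \in labels v.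
  apply: contraT => kv; have := pairing Ww (x := k).
  rewrite /= wE !map_cat /= !(inE, mem_cat) eqxx !orbT => /(_ isT).
  rewrite !count_cat /= !eqxx.
  move: kv kw1 kw2; rewrite -!has_pred1 !has_count -!eqn0Ngt => /eqP -> /eqP -> /eqP ->.
  have -> : (i == k) = false by apply/eqP => /esym.
  by have -> : (j == k) = false by apply/eqP => /esym.
have [v1 [e' [v2 [vE kv1]]]] := split_label kv.
(* A second occurrence of i beyond k alternates with k. *)
have cross_i : i \in labels (w2 ++ (j, d) :: v1) -> cross_distances C y.
  move=> hi; exists i, k, c, e, w1, (w2 ++ (j, d) :: v); split=> //.
    by move: Ww; rewrite wE /= -catA.
  rewrite /crosses; apply/andP; split; first by apply/eqP => /esym.
  apply/orP; left; rewrite vE /= eqxx map_cat /=.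
  apply: subseq_cons_cat.
  have -> : labels (w2 ++ (j, d) :: v1 ++ (k, e') :: v2) =
    labels (w2 ++ (j, d) :: v1) ++ k :: labels v2 by rewrite !map_cat /= !map_cat -catA.
  apply: (@cat_subseq _ [:: i] [:: k]); first by rewrite sub1seq.
  by rewrite sub1seq inE eqxx.
case: hyp => [[ij iw]|[cr _]].
  by left; apply: cross_i; rewrite map_cat mem_cat /= inE ij eqxx orbT.
have [/cross_i hi|hi] := boolP (i \in labels (w2 ++ (j, d) :: v1)); first by left.
right; split; first by case/andP: cr => /eqP.
rewrite zy; exists k, j, e, d, w2, (v ++ (i, c) :: w1); split=> //.
have [hj|hj] := boolP (j \in labels (v2 ++ (i, c) :: w1)).
  rewrite /crosses; apply/andP; split; first by apply/eqP.
  apply/orP; left; rewrite vE /= eqxx map_cat /=; apply: subseq_cons_cat.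
  rewrite -catA /= map_cat /=; apply: subseq_cons_cat.
  by rewrite sub1seq.
have [ij /orP cr'] : i != j /\ (subseq [:: i; j; i; j] (labels ((i, c) :: w ++ (j, d) :: v))
   || subseq [:: j; i; j; i] (labels ((i, c) :: w ++ (j, d) :: v))) by apply/andP.
(* Now i occurs only outside, j only inside the arc between the letters k. *)
exfalso; move: cr'.
have -> : labels ((i, c) :: w ++ (j, d) :: v) =
   (i :: rcons (labels w1) k) ++ labels (w2 ++ (j, d) :: v1) ++ (k :: labels v2).
  by rewrite vE wE /= !map_cat /= !map_cat /= cat_rcons -!catA.
set A := _ :: rcons _ _; set B := labels (_ ++ _ :: v1); set D := k :: _.
have jk : j != k by apply/eqP => /esym.
have jA : j \notin A.
  rewrite inE eq_sym (negbTE ij) mem_rcons inE (negbTE jk) /=.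
  by apply: contra hj; rewrite map_cat mem_cat /= inE => ->; rewrite !orbT.
have jD : j \notin D.
  by rewrite inE (negbTE jk) /=; apply: contra hj; rewrite map_cat mem_cat => ->.
have skip (x : nat) (s t1 t2 : seq nat) : x \notin t1 ->
    subseq (x :: s) (t1 ++ t2) -> subseq (x :: s) t2.
  by elim: t1 => //= a t1 IH; rewrite inE negb_or => /andP [/negbTE ->].
have tl (x : nat) (s t : seq nat) : subseq (x :: s) t -> subseq s t.
  exact/subseq_trans/subseq_cons.
have fin s : subseq [:: j, i, j & s] (A ++ B ++ D) -> False.
  move/(skip _ _ _ _ jA)/tl/(skip _ _ _ _ hi)/tl/mem_subseq/(_ j).
  by rewrite inE eqxx (negbTE jD) => /(_ isT).
by case=> [/tl|]; apply: fin.
Qed.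

End Pairing.

(** * Consequences for pairings, and the shape of L and K *)

Section Pairing_crossings.
Variable C : set tcpart.
Hypothesis HC : category C.
Notation W := (realizable C).
Notation dist := (distances C).
Notation X := (cross_distances C).
Hypothesis pairing :
  forall w, W w -> {in labels w, forall i, count_mem i (labels w) = 2}.

Section Modulus.
Variable m : nat.
Hypothesis m0 : (0 < m)%N.
Hypothesis dist_m : forall c d k, dist c d k -> (m %| k)%Z.

(** Between legs of opposite colors at distance [m] every class of levels is
crossed once. *)
Lemma cross_all r : dist White Black m%:Z -> exists2 y, residue_class m r y & X y.
Proof.
case=> i [w [v [Ww iw mE]]].
have [phi [phi1 phim _]] := residue_class_parity m r.
have [|y hy [Xy|[]//]] := cross_of_odd HC pairing dist_m (r := r) Ww _ (or_introl (conj erefl iw)).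
  rewrite (odd_levels phi1).
  have -> : sigma w = m%:Z * 1 by rewrite mE addr0 mulr1.
  by rewrite phim // addbA addbb.
by exists y.
Qed.

(** Between legs of equal color at distance [m] the class of the legs
themselves is missed, every other one is crossed once. *)
Lemma cross_nonzero r : dist White White m%:Z -> ~~ (m %| r)%Z ->
  exists2 y, residue_class m r y & X y.
Proof.
case=> i [w [v [Ww iw mE]]] mr.
have [phi [phi1 phim _]] := residue_class_parity m r.
have [|y hy [Xy|[]//]] := cross_of_odd HC pairing dist_m (r := r) Ww _ (or_introl (conj erefl iw)).
  rewrite (odd_levels phi1).
  have -> : start_height White + sigma w = 0 + m%:Z * 1.
    by rewrite mE /half_sum /start_height /=; ring.
  have -> : start_height White = 0 + 1 by [].
  rewrite phim // phi1 /residue_class sub0r rpredN (negbTE mr).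
  by case: (phi _).
by exists y.
Qed.

(** A total color sum [m q] meets each class of levels with the parity of [q],
and the letters of the class are paired. *)
Lemma sigma_even w : W w -> (m%:Z * 2 %| sigma w)%Z.
Proof.
move=> Ww; have /dvdzP [q sE] := dist_m (@sigma_dist _ HC w White Ww).
have [phi [phi1 phim _]] := residue_class_parity m 0.
have /negP : ~ odd (count (fun a => residue_class m 0 a.2) (levels 0 w)).
  have Ww' : W ([::] ++ w ++ [::]) by rewrite cats0.
  case/(leaving_strand HC pairing dist_m Ww') => w1 [i [c [w2 [wE i1 i2 _]]]].
  have := pairing Ww (x := i).
  rewrite wE !map_cat /= !(inE, mem_cat) eqxx !orbT => /(_ isT).
  rewrite !count_cat /= !eqxx.
  by move: i1 i2; rewrite -!has_pred1 !has_count -!eqn0Ngt => /eqP -> /eqP ->.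
rewrite (odd_levels phi1) sE mulrC phim // addbA addbb /= => oq.
rewrite dvdz_mul2l; first by rewrite dvdzE dvdn2.
by rewrite eqz_nat -lt0n.
Qed.

End Modulus.

Section Modulus0.
Hypothesis dist_0 : forall c d k, dist c d k -> k = 0.

Let dist_m c d k : dist c d k -> (0%N %| k)%Z.
Proof. by move/dist_0 ->. Qed.

Let residue_class0 r y : residue_class 0 r y -> y = r.
Proof. by rewrite /residue_class dvd0z subr_eq0 => /eqP. Qed.

(** Between two white legs of the same level the height descends by one,
through that level. *)
Lemma cross_zero : dist White White 0 -> X 0.
Proof.
case=> i [w [v [Ww iw mE]]].
have [phi [phi1 _ phi0]] := residue_class_parity 0 0.
have [|y /residue_class0 -> [Xy|[]//]] := cross_of_odd HC pairing dist_m (r := 0) Ww _ (or_introl (conj erefl iw)).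
  rewrite (odd_levels phi1) !phi0 // /start_height /=.
  have -> : sigma w = - 1 by move: mE; rewrite /half_sum /=; lia.
  by [].
by [].
Qed.

(** The level [x] lies strictly between the levels of the two crossing points,
so a strand of this level crosses one of their strands. *)
Lemma cross_split x y : 0 < x -> 0 < y -> X (x + y) -> X x \/ X y.
Proof.
move=> x0 y0 [i [j [c [d [w [v [Ww cr zE]]]]]]].
have [phi [phi1 _ phi0]] := residue_class_parity 0 x.
have [||t /residue_class0 -> [|[_]]] := cross_of_odd HC pairing dist_m (r := x) Ww.
- rewrite (odd_levels phi1) !phi0 //.
  have -> : start_height c + sigma w = x + y - level_offset d.
    by rewrite zE half_sum_level /start_height; ring.
  by clear -x0 y0; case: c d => -[]; rewrite /start_height /=; lia.
- right; split=> // t /residue_class0 ->; rewrite -zE !dvd0z; lia.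
- by left.
- by rewrite -zE [x + y]addrC addrK; right.
Qed.

End Modulus0.
End Pairing_crossings.

Section Assembly.
Variable C : set tcpart.
Hypothesis HC : category C.
Notation W := (realizable C).
Notation dist := (distances C).
Notation X := (cross_distances C).

Lemma block_sum_cat i w1 w2 : block_sum i (w1 ++ w2) = block_sum i w1 + block_sum i w2.
Proof. exact: big_cat. Qed.

Lemma block_sum_cons i a w :
  block_sum i (a :: w) = (if a.1 == i then color_sign a.2 else 0) + block_sum i w.
Proof. by rewrite /block_sum big_cons; case: eqP; rewrite ?add0r. Qed.

Lemma block_sum_notin i w : i \notin labels w -> block_sum i w = 0.
Proof.
elim: w => [|a w IH]; first by rewrite /block_sum big_nil.
rewrite /= inE negb_or eq_sym => /andP [/negbTE ia /IH h].
by rewrite block_sum_cons ia h.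
Qed.

Lemma count_notin i (w : word) : i \notin labels w -> count_mem i (labels w) = 0%N.
Proof. by rewrite -has_pred1 has_count -eqn0Ngt => /eqP. Qed.

Lemma short_block_cases w i : short_blocks C -> W w -> i \in labels w ->
  (count_mem i (labels w) = 1%N /\ exists c, block_sum i w = color_sign c) \/
  (count_mem i (labels w) = 2%N /\ exists c d k, dist c d k /\
    block_sum i w = color_sign c + color_sign d).
Proof.
move=> short Ww /split_label [w1 [c [w2 [wE iw1]]]].
have sh := short _ Ww i; move: sh; rewrite wE map_cat count_cat /= eqxx.
rewrite block_sum_cat block_sum_cons /= eqxx block_sum_notin // count_notin //.
rewrite !add0r !add0n.
have [/split_label [w3 [d [w4 [w2E iw3]]]]|iw2] := boolP (i \in labels w2); last first.
  by left; rewrite count_notin // block_sum_notin // addr0; split=> //; exists c.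
rewrite w2E map_cat count_cat /= eqxx (count_notin iw3) add0n !add1n => sh.
have iw4 : i \notin labels w4.
  by apply/count_memPn; move: sh; case: (count_mem i (labels w4)).
right; rewrite count_notin //; split=> //.
exists c, d, (sigma w3 + half_sum c d); split.
  exists i, w3, (w4 ++ w1); split=> //.
  move: Ww; rewrite wE w2E => /(realizable_rot HC).
  by rewrite /= -catA.
rewrite block_sum_cat block_sum_cons /= eqxx (block_sum_notin iw3).
by rewrite (block_sum_notin iw4) add0r addr0.
Qed.

Lemma dist_block_sum c d k : short_blocks C -> dist c d k ->
  exists w i, [/\ W w, i \in labels w & color_sign c + color_sign d = block_sum i w].
Proof.
move=> short [i [w1 [w2 [Ww iw _]]]].
exists ((i, c) :: w1 ++ (i, d) :: w2), i; split=> //; first by rewrite inE eqxx.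
have iw2 : i \notin labels w2.
  have := short _ Ww i; rewrite /= map_cat count_cat /= !eqxx.
  by rewrite -has_pred1 has_count; move: (count _ _) (count _ _) => a b; lia.
rewrite block_sum_cons block_sum_cat block_sum_cons /= !eqxx.
by rewrite !block_sum_notin // addr0 add0r.
Qed.

Lemma Kset_eq A : (forall c, dist c (opp_color c) = A) -> Kset (analyzer C) = A.
Proof.
move=> h; rewrite Kset_words //; apply/seteqP; split=> k.
  by case=> c; rewrite h.
by move=> hk; exists White; rewrite h.
Qed.

Lemma Lset_eq A : (forall c, dist c c = A) -> Lset (analyzer C) = A.
Proof.
move=> h; rewrite Lset_words //; apply/seteqP; split=> k.
  by case=> c; rewrite h.
by move=> hk; exists White; rewrite h.
Qed.

Lemma Sset_subgroup : exists g : nat, Sset (analyzer C) = mulZ g%:Z.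
Proof.
rewrite Sset_words //; apply: subgroup_mulZ.
  by exists [::]; [exact: realizable_nil | rewrite sigma_nil].
move=> _ _ [w Ww ->] [v Wv ->].
have [g [_ gw Wg]] : exists g : nat -> nat, [/\ True,
    {in labels w & labels (relabel g (reflect_word v)), forall a b, a != b} &
    W (relabel g (reflect_word v))].
  have [N hN] := fresh_label (labels w).
  exists (addn N); split=> //; last first.
    apply: realizable_relabel; first by move=> x y _ _ /addnI.
    exact: realizable_reflect.
  move=> a b /hN aN; rewrite labels_relabel => /mapP [x _ ->].
  by apply/eqP; lia.
exists (w ++ relabel g (reflect_word v)); first exact: realizable_cat.
by rewrite sigma_cat sigma_relabel sigma_reflect.
Qed.

Lemma Sset_multiple (g : nat) : (forall w, W w -> (g%:Z %| sigma w)%Z) ->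
  exists u : nat, Sset (analyzer C) = mulZ (u%:Z * g%:Z).
Proof.
have [n nE] := Sset_subgroup; move=> h.
suff /dvdnP [u uE] : (g %| n)%N by exists u; rewrite nE uE PoszM.
have : mulZ n%:Z n%:Z by apply/mulZE; rewrite dvdzz.
by rewrite -nE Sset_words // => -[w /h + e]; rewrite -e.
Qed.

Lemma Sset_zero : (forall w, W w -> sigma w = 0) -> Sset (analyzer C) = [set 0].
Proof.
move=> h; rewrite Sset_words //; apply/seteqP; split=> z /=.
  by case=> w /h ->.
by move=> ->; exists [::]; [exact: realizable_nil | rewrite sigma_nil].
Qed.

Lemma mulZ0 : mulZ 0 = [set 0].
Proof.
apply/seteqP; split=> z; first by case=> t _ <-; rewrite mul0r.
by move=> ->; exists 0; rewrite ?mul0r.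
Qed.

(** If the coset [l + m Z] is symmetric but not [m Z] itself, then [l] is an
odd multiple of half of [m]. *)
Lemma distances_shape : short_blocks C \/ dist White White 0 ->
  exists m : nat, (forall c, dist c (opp_color c) = mulZ m%:Z) /\
  [\/ forall c, dist c c = set0, forall c, dist c c = mulZ m%:Z |
      exists n : nat, [/\ (0 < n)%N, m = (2 * n)%N &
         forall c, dist c c = shift_set n%:Z (2 * n%:Z) setT]].
Proof.
move=> hyp; have [m hm] : exists m : nat, forall c, dist c (opp_color c) = mulZ m%:Z.
  apply: distances_unlike_subgroup => //.
  by case: hyp => h; [left | right; exists 0].
exists m; split=> //.
case: (distances_like_coset HC hyp hm) => [h|[l h hl]]; first by constructor 1.
have eqs (a b t : int) : (t %| a - b)%Z -> shift_set a t setT = shift_set b t setT.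
  case/dvdzP=> q e; apply/seteqP; split=> k [z _ <-].
    exists (z + q) => //; rewrite mulrDr [t * q]mulrC -e; ring.
  exists (z - q) => //; rewrite mulrBr [t * q]mulrC -e; ring.
have shift0 (t : int) : shift_set 0 t setT = mulZ t.
  by apply/seteqP; split=> k [z _ <-]; exists z => //; rewrite add0r.
move/mulZE/dvdzP: h => [q qE].
have [ml|nml] := boolP (m %| l)%Z.
  by constructor 2 => c; rewrite hl (eqs l 0) ?subr0.
constructor 3; exists (m %/ 2)%N.
(* For even q, the number l would lie in m Z. *)
have oq : exists t, q = 2 * t + 1.
  exists (q %/ 2)%Z; have := modz_ge0 q (isT : 2 != 0 :> int).
  have := ltz_pmod q (isT : 0 < 2 :> int); have := divz_eq q 2.
  have [r0|r0] := eqVneq (q %% 2)%Z 0; last by lia.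
  rewrite r0 => qq _ _; exfalso; case/negP: nml; apply/dvdzP.
  by exists (q %/ 2)%Z; move: qE; rewrite {1}qq; nia.
case: oq => t tE.
have m2 : (m = 2 * (m %/ 2))%N.
  have : (2 %| m%:Z)%Z.
    by apply/dvdzP; exists (l - t * m%:Z); move: qE; rewrite tE; nia.
  by rewrite /dvdz /= => /divnK; rewrite mulnC.
split=> //.
  rewrite lt0n; apply: contra nml => /eqP m0.
  by move: qE; rewrite m2 m0 !muln0 mulr0 => h; apply/dvdzP; exists 0; lia.
move=> c; rewrite hl.
have -> : 2 * (m %/ 2)%N%:Z = m%:Z by rewrite {2}m2 PoszM.
apply: eqs; apply/dvdzP; exists t; move: qE; rewrite tE {1 3}m2 PoszM; nia.
Qed.

Lemma cross_periodic l : (forall d, exists e, dist d e l) ->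
  forall z, X z -> X (z + l).
Proof. by move=> h z Xz; apply: cross_distances_add. Qed.

End Assembly.

(** * The three cases *)

Lemma block_sum_reflect i w : block_sum i (reflect_word w) = - block_sum i w.
Proof.
elim: w => [|a w IH]; first by rewrite /block_sum !big_nil oppr0.
rewrite reflect_cons block_sum_cat IH !block_sum_cons /block_sum big_nil /=.
by rewrite color_sign_opp addr0 opprD addrC; case: ifP; rewrite ?oppr0.
Qed.

Section Cases.
Variable C : set tcpart.
Hypothesis HC : category C.
Notation W := (realizable C).
Notation dist := (distances C).
Notation X := (cross_distances C).

Lemma analyzer_eq f v s l k x :
  Fset (analyzer C) = f -> Vset (analyzer C) = v -> Sset (analyzer C) = s ->
  Lset (analyzer C) = l -> Kset (analyzer C) = k -> Xset (analyzer C) = x ->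
  analyzer C = Sextuple f v s l k x.
Proof. by move=> <- <- <- <- <- <-. Qed.

Lemma realizable_pair0 : W [:: (0%N, White); (0%N, Black)].
Proof. exact: realizable_pair. Qed.

Section Periodic.
Variable m : nat.
Hypothesis hm : forall c, dist c (opp_color c) = mulZ m%:Z.

Lemma cross_periodic_m z t : X z -> X (z + m%:Z * t).
Proof.
apply: cross_periodic => // d; exists (opp_color d); rewrite hm.
by exists t.
Qed.

Lemma sigma_dvd w : W w -> (m %| sigma w)%Z.
Proof. by move=> /(sigma_dist HC White); rewrite hm mulZE. Qed.

Lemma Sset_unlike_multiple : exists u : nat, Sset (analyzer C) = mulZ (u%:Z * m%:Z).
Proof. by apply: Sset_multiple => // w; apply: sigma_dvd. Qed.

Lemma Sset_unlike_zero : m = 0%N -> Sset (analyzer C) = [set 0].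
Proof.
move=> m0; apply: Sset_zero => // w /sigma_dvd.
by rewrite m0 dvd0z => /eqP.
Qed.

End Periodic.

(** Even multiples of [n] come from legs of opposite colors, odd ones from
legs of equal color. *)
Lemma cross_periodic_half (n : nat) :
  (forall c, dist c (opp_color c) = mulZ (2 * n%:Z)) ->
  (forall c, dist c c = shift_set n%:Z (2 * n%:Z) setT) ->
  forall z t, X z -> X (z + n%:Z * t).
Proof.
move=> hk hl z t; apply: cross_periodic => // d.
have := divz_eq t 2; have := modz_ge0 t (isT : 2 != 0 :> int).
have := ltz_pmod t (isT : 0 < 2 :> int); set q := (t %/ 2)%Z; set r := (t %% 2)%Z.
move=> r2 r0 tE; have [rE|rE] := eqVneq r 0.
  exists (opp_color d); rewrite hk; exists q => //.
  by rewrite tE rE addr0; ring.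
exists d; rewrite hl; exists q => //.
by rewrite tE (_ : r = 1); [ring | lia].
Qed.

Lemma Xset_periodic (m : nat) : (0 < m)%N -> (forall z t, X z -> X (z + m%:Z * t)) ->
  exists2 D : set int, D `<=` [set 0] `|` upto (m %/ 2)%N &
    Xset (analyzer C) = setT `\` sub_m D m%:Z.
Proof.
move=> m0 hX; rewrite Xset_words //.
exists [set z | 0 <= z <= (m %/ 2)%:Z /\ ~ X z].
  move=> z [/andP [z0 zm] _]; have [->|zn] := eqVneq z 0; [by left | right].
  by rewrite /upto /= zm andbT; lia.
by apply: complement_sub_m => //; apply: cross_distances_opp.
Qed.

Lemma Xset_symmetric : exists2 E : set int, E `<=` [set 0] `|` posints &
    Xset (analyzer C) = setT `\` sub_m E 0.
Proof.
rewrite Xset_words //.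
exists [set z | 0 <= z /\ ~ X z].
  move=> z [z0 _]; have [->|zn] := eqVneq z 0; [by left | right].
  by rewrite /posints /=; lia.
by apply: complement_sub_0; apply: cross_distances_opp.
Qed.

Section CaseS.
Hypothesis Ws : W word_s.
Hypothesis Wf : W word_f.

(** Detach a black point of [f]: its two neighbors become subsequent and are
both white. *)
Lemma distance_zero_like : dist White White 0.
Proof.
have [n] := realizable_detach HC (w1 := [:: _]) Ws Wf.
rewrite /= !inE => hn W'.
exists 0%N, [:: (n, Black)], [:: (0%N, Black)]; split=> //.
  by rewrite /= inE eq_sym; move: hn; rewrite !negb_or => /andP [].
by rewrite sigma_cons sigma_nil.
Qed.

(** Gluing [f] to a leg triples it with alternating colors; detaching the
middle point enlarges the block by one white leg. *)
Lemma large_blocks (n : nat) : exists i w,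
  [/\ W ((i, White) :: w), count_mem i (labels ((i, White) :: w)) = n.+1 &
      block_sum i ((i, White) :: w) = n.+1%:Z].
Proof.
elim: n => [|n [i [w [Ww cw bw]]]].
  by exists 0%N, [:: (1%N, Black)]; split=> //; rewrite !block_sum_cons /block_sum big_nil.
have Wf' : W [:: (0%N, Black); (0%N, White); (0%N, Black); (0%N, White)].
  exact: (realizable_rot HC (w1 := [:: _])) Wf.
have [g [injg gi _ Wg]] := realizable_gluing HC (w1 := [::]) (v1 := [::]) Ww Wf'.
move: Wg; rewrite /= gi => Wg.
have [k] := realizable_detach HC (w1 := [:: _]) Ws Wg.
rewrite /= !inE negb_or => /andP [/negbTE ki _] Wk.
exists i, ((k, Black) :: (i, White) :: w); split=> //.
  by move: cw; rewrite /= eqxx ki => <-.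
rewrite block_sum_cons block_sum_cons bw /= eqxx ki add0r -PoszD.
by rewrite add1n.
Qed.

Lemma Fset_S : Fset (analyzer C) = posints.
Proof.
rewrite Fset_words //; apply/seteqP; split=> z /=.
  case=> w [i [_ iw ->]]; rewrite /posints /=.
  by rewrite ltz_nat -has_count has_pred1.
case: z => [[|n]|n] // _; have [i [w [Ww cw _]]] := large_blocks n.
by exists ((i, White) :: w), i; split=> //; [rewrite inE eqxx | rewrite cw].
Qed.

Lemma Vset_S : Vset (analyzer C) = setT.
Proof.
rewrite Vset_words //; apply/seteqP; split=> z //= _.
case: z => [[|n]|n].
- exists [:: (0%N, White); (0%N, Black)], 0%N; split=> //; first exact: realizable_pair0.
  by rewrite !block_sum_cons /block_sum big_nil.
- have [i [w [Ww _ bw]]] := large_blocks n.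
  by exists ((i, White) :: w), i; split=> //; rewrite inE eqxx.
- have [i [w [Ww _ bw]]] := large_blocks n.
  exists (reflect_word ((i, White) :: w)), i; split=> //.
  + exact: realizable_reflect.
  + by rewrite mem_labels_reflect inE eqxx.
  + by rewrite block_sum_reflect bw NegzE.
Qed.

Lemma case_S : Qrange (analyzer C).
Proof.
have [m [hm hl]] := distances_shape HC (or_intror distance_zero_like).
have {}hl c : dist c c = mulZ m%:Z.
  case: hl => [h|//|[n [n0 _ h]]].
    by have := distance_zero_like; rewrite h.
  have := distance_zero_like; rewrite h => -[t _ e]; exfalso.
  have : n%:Z * (1 + 2 * t) = 0 by rewrite -[RHS]e; ring.
  by move/eqP; rewrite mulf_eq0; lia.
have [m0|] := posnP m; last move=> m0.
  have [E hE xE] := Xset_symmetric.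
  rewrite (analyzer_eq Fset_S Vset_S (Sset_unlike_zero hm m0) (Lset_eq HC hl) (Kset_eq HC hm) xE).
  by rewrite m0 mulZ0; apply: Q14.
have [D hD xD] := Xset_periodic m0 (cross_periodic_m hm).
have [u uE] := Sset_unlike_multiple hm.
rewrite (analyzer_eq Fset_S Vset_S uE (Lset_eq HC hl) (Kset_eq HC hm) xD).
exact: Q13.
Qed.

End CaseS.

Lemma short_of_not_f : ~ W word_f -> short_blocks C.
Proof.
move=> nf w Ww i; rewrite leqNgt; apply/negP => h; apply: nf.
have /split_label [w1 [c [w2 [wE iw1]]]] : i \in labels w.
  by rewrite -has_pred1 has_count; apply: leq_trans h.
move: h; rewrite wE map_cat count_cat /= eqxx (count_notin iw1) add0n add1n ltnS.
move=> h; have /split_label [w3 [d [w4 [w2E iw3]]]] : i \in labels w2.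
  by rewrite -has_pred1 has_count; apply: leq_trans h.
move: h; rewrite w2E map_cat count_cat /= eqxx (count_notin iw3) add0n add1n ltnS.
rewrite -has_count has_pred1 => iw4.
apply: (@triple_word_f C HC i c d w3 (w4 ++ w1)).
  move: Ww; rewrite wE w2E => /(realizable_rot HC).
  by rewrite /= -catA.
by rewrite map_cat mem_cat iw4.
Qed.

Lemma sign_sum c d : d <> c -> color_sign c + color_sign d = 0 :> int.
Proof. by case: c d => -[]. Qed.

Lemma pmP (A : set int) z : pm A z <-> A z \/ A (- z).
Proof.
split=> [[h|[t At <-]]|[h|h]]; [by left|by right; rewrite opprK|by left|].
by right; exists (- z); rewrite ?opprK.
Qed.

Section CaseB.
Hypothesis Ws : W word_s.
Hypothesis short : short_blocks C.

Lemma Fset_B : Fset (analyzer C) = [set 1; 2].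
Proof.
rewrite Fset_words //; apply/seteqP; split=> z /=.
  case=> w [i [Ww iw ->]].
  by case: (short_block_cases HC short Ww iw) => -[-> _]; [left|right].
case=> ->; first by exists word_s, 0%N; split.
by exists [:: (0%N, White); (0%N, Black)], 0%N; split=> //; exact: realizable_pair0.
Qed.

Lemma Vset_B_sub w i : W w -> i \in labels w ->
  pm [set 0; 1] (block_sum i w) \/
  exists c k, dist c c k /\ block_sum i w = color_sign c + color_sign c.
Proof.
move=> Ww iw.
case: (short_block_cases HC short Ww iw) => -[_]; last first.
  case=> c [d [k [hk ->]]]; have [dc|/eqP /sign_sum ->] := eqVneq d c.
    by right; exists c, k; move: hk; rewrite dc.
  by left; apply/pmP; left; left.
by case=> c ->; left; apply/pmP; case: c; [left; right|right; right].
Qed.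

Lemma Vset_B_sup z : pm [set 0; 1] z -> Vset (analyzer C) z.
Proof.
rewrite Vset_words // => /pmP h; rewrite /=.
have [z0|[z1|z1]] : z = 0 \/ z = 1 \/ z = -1.
  case: h => -[/= h|/= h]; [by left | by right; left | left | right; right].
    by apply: oppr_inj; rewrite h oppr0.
  by rewrite -h opprK.
- exists [:: (0%N, White); (0%N, Black)], 0%N; split=> //; first exact: realizable_pair0.
  by rewrite !block_sum_cons /block_sum big_nil.
- exists word_s, 0%N; split=> //.
  by rewrite !block_sum_cons /block_sum big_nil.
- exists word_s, 1%N; split=> //.
  by rewrite !block_sum_cons /block_sum big_nil.
Qed.

Lemma Vset_B_unlike : (forall c, dist c c = set0) ->
  Vset (analyzer C) = pm [set 0; 1].
Proof.
move=> h; apply/seteqP; split=> z; last exact: Vset_B_sup.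
rewrite Vset_words // => -[w [i [Ww iw ->]]].
case: (Vset_B_sub Ww iw) => // -[c [k [+ _]]].
by rewrite h.
Qed.

Lemma Vset_B_like : (forall c, dist c c !=set0) ->
  Vset (analyzer C) = pm [set 0; 1; 2].
Proof.
move=> h; apply/seteqP; split=> z.
  rewrite Vset_words // => -[w [i [Ww iw ->]]].
  case: (Vset_B_sub Ww iw) => [/pmP|[c [k [_ ->]]]].
    by case=> hz; apply/pmP; [left|right]; left.
  by apply/pmP; case: c; [left; right|right; right].
move=> hz; have [h1|[c ->]] : pm [set 0; 1] z \/ exists c, z = color_sign c + color_sign c.
  case/pmP: hz => -[hz|/= hz].
  - by left; apply/pmP; left.
  - by right; exists White.
  - by left; apply/pmP; right.
  - by right; exists Black; rewrite -[z]opprK hz.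
  exact: Vset_B_sup.
have [k hk] := h c.
rewrite Vset_words //; have [w [i [Ww iw e]]] := dist_block_sum short hk.
by exists w, i.
Qed.

Lemma case_B : Qrange (analyzer C).
Proof.
have [m [hm]] := distances_shape HC (or_introl short).
have hK := Kset_eq HC hm.
have [m0|m0] := posnP m.
  have [E hE xE] := Xset_symmetric; have sE := Sset_unlike_zero hm m0.
  case=> [hl|hl|[n [n0 mn _]]]; last by exfalso; lia.
    rewrite (analyzer_eq Fset_B (Vset_B_unlike hl) sE (Lset_eq HC hl) hK xE).
    by rewrite m0 mulZ0; apply: Q12.
  have hv : forall c, dist c c !=set0 by move=> c; rewrite hl; exists 0; exists 0; rewrite ?mulr0.
  rewrite (analyzer_eq Fset_B (Vset_B_like hv) sE (Lset_eq HC hl) hK xE).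
  by rewrite m0 mulZ0; apply: Q11.
have [u uE] := Sset_unlike_multiple hm.
case=> [hl|hl|[n [n0 mn hl]]].
- have [D hD xD] := Xset_periodic m0 (cross_periodic_m hm).
  rewrite (analyzer_eq Fset_B (Vset_B_unlike hl) uE (Lset_eq HC hl) hK xD).
  exact: Q10.
- have hv : forall c, dist c c !=set0 by move=> c; rewrite hl; exists 0; exists 0; rewrite ?mulr0.
  have [D hD xD] := Xset_periodic m0 (cross_periodic_m hm).
  rewrite (analyzer_eq Fset_B (Vset_B_like hv) uE (Lset_eq HC hl) hK xD).
  exact: Q8.
- have mE : m%:Z = 2 * n%:Z by rewrite mn PoszM.
  have hv : forall c, dist c c !=set0.
    by move=> c; rewrite hl; exists n%:Z; exists 0; rewrite ?mulr0 ?addr0.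
  have [D hD xD] := Xset_periodic n0 (cross_periodic_half (eq_ind _ (fun t =>
     forall c, dist c (opp_color c) = mulZ t) hm _ mE) hl).
  rewrite (analyzer_eq Fset_B (Vset_B_like hv) uE (Lset_eq HC hl) hK xD).
  by rewrite mE mulrCA mulrA; apply: Q9.
Qed.

End CaseB.

Section CaseO.
Hypothesis not_s : ~ W word_s.
Hypothesis short : short_blocks C.

Lemma pairing_O w : W w -> {in labels w, forall i, count_mem i (labels w) = 2%N}.
Proof.
move=> Ww i iw; have := short Ww i; rewrite leq_eqVlt => /orP [/eqP //|].
rewrite ltnS => h; exfalso; apply: not_s.
have [w1 [c [w2 [wE iw1]]]] := split_label iw.
apply: (@singleton_word_s C HC i c (w2 ++ w1)).
  by move: Ww; rewrite wE => /(realizable_rot HC).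
rewrite map_cat mem_cat negb_or iw1 andbT; apply/count_memPn.
move: h; rewrite wE map_cat count_cat /= eqxx (count_notin iw1).
by case: (count_mem i (labels w2)).
Qed.

Lemma Fset_O : Fset (analyzer C) = [set 2].
Proof.
rewrite Fset_words //; apply/seteqP; split=> z /=.
  by case=> w [i [Ww iw ->]]; rewrite pairing_O.
move=> ->; exists [:: (0%N, White); (0%N, Black)], 0%N; split=> //; exact: realizable_pair0.
Qed.

Lemma Vset_O_sub w i : W w -> i \in labels w -> exists c d k,
  dist c d k /\ block_sum i w = color_sign c + color_sign d.
Proof.
move=> Ww iw; case: (short_block_cases HC short Ww iw) => -[c2 //].
by have := pairing_O Ww iw; rewrite c2.
Qed.

Lemma Vset_O_0 : Vset (analyzer C) 0.
Proof.
rewrite Vset_words //.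
exists [:: (0%N, White); (0%N, Black)], 0%N; split=> //; first exact: realizable_pair0.
by rewrite !block_sum_cons /block_sum big_nil.
Qed.

Lemma Vset_O_unlike : (forall c, dist c c = set0) -> Vset (analyzer C) = [set 0].
Proof.
move=> h; apply/seteqP; split=> z; last by move=> ->; exact: Vset_O_0.
rewrite Vset_words // => -[w [i [Ww iw ->]]] /=.
have [c [d [k [hk ->]]]] := Vset_O_sub Ww iw.
have [dc|/eqP /sign_sum //] := eqVneq d c.
by move: hk; rewrite dc h.
Qed.

Lemma Vset_O_like : (forall c, dist c c !=set0) ->
  Vset (analyzer C) = pm [set 0; 2].
Proof.
move=> h; apply/seteqP; split=> z.
  rewrite Vset_words // => -[w [i [Ww iw ->]]] /=.
  have [c [d [k [hk ->]]]] := Vset_O_sub Ww iw.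
  have [->|/eqP /sign_sum ->] := eqVneq d c; apply/pmP; last by left; left.
  by case: c {hk}; [left; right|right; right].
move=> hz; have [->|[c ->]] : z = 0 \/ exists c, z = color_sign c + color_sign c.
  case/pmP: hz => -[/= hz|/= hz].
  - by left.
  - by right; exists White.
  - by left; apply: oppr_inj; rewrite hz oppr0.
  - by right; exists Black; rewrite -[z]opprK hz.
  exact: Vset_O_0.
have [k hk] := h c.
rewrite Vset_words //; have [w [i [Ww iw e]]] := dist_block_sum short hk.
by exists w, i.
Qed.

(** The total color sum is the sum of the color sums of the blocks, which all
vanish. *)
Lemma Sset_O_unlike : (forall c, dist c c = set0) -> Sset (analyzer C) = [set 0].
Proof.
move/Vset_O_unlike => hV; apply/seteqP; split=> z; last first.
  by move=> ->; rewrite Sset_words //; exists [::]; [exact: realizable_nil | rewrite sigma_nil].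
case=> p Cp <-; rewrite /total_color_sum /color_sum /=.
rewrite (finset.set_partition_big _ (blocksP p)) /= big1 // => B hB.
have : Vset (analyzer C) (color_sum B) by exists p, B.
by rewrite hV.
Qed.

Let N := [set z | 0 < z /\ ~ X z].

Lemma case_O_zero : (forall c, dist c (opp_color c) = mulZ 0) ->
  ((forall c, dist c c = set0) \/ (forall c, dist c c = mulZ 0)) ->
  Qrange (analyzer C).
Proof.
move=> hm hl; have hK := Kset_eq HC hm.
have sE : Sset (analyzer C) = [set 0] by apply: (@Sset_unlike_zero 0%N).
have dist_0 c d k : dist c d k -> k = 0.
  have [->|/eqP dc] := eqVneq d c.
    by case: hl => h; rewrite h // mulZ0.
  have -> : d = opp_color c by case: c d dc => -[].
  by rewrite hm mulZ0.
have sN : subsemigroup N.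
  split=> [z []//|x y [x0 hx] [y0 hy]]; split; first exact: addr_gt0.
  by move/(cross_split HC pairing_O dist_0 x0 y0) => [].
have xE := complement_sub_0 (cross_distances_opp HC).
have X0_N : X 0 -> Xset (analyzer C) = setT `\` sub_m N 0.
  move=> X0; rewrite Xset_words // xE; congr (_ `\` sub_m _ _).
  apply/seteqP; split=> z [z0 hz]; split=> //; last exact: ltW.
  by rewrite lt_neqAle z0 andbT; apply/eqP => e; apply: hz; rewrite -e.
case: hl => hl; last first.
  have hv : forall c, dist c c !=set0 by move=> c; rewrite hl mulZ0; exists 0.
  rewrite (analyzer_eq Fset_O (Vset_O_like hv) sE (Lset_eq HC hl) hK (X0_N _)).
    by rewrite mulZ0; apply: Q5.
  by apply: (cross_zero HC pairing_O dist_0); rewrite hl mulZ0.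
have [X0|nX0] := pselect (X 0).
  rewrite (analyzer_eq Fset_O (Vset_O_unlike hl) sE (Lset_eq HC hl) hK (X0_N X0)).
  by rewrite mulZ0; apply: Q6.
have X_N' : Xset (analyzer C) = setT `\` sub_m' N 0.
  rewrite Xset_words // xE; congr (_ `\` _).
  apply/seteqP; split=> z [a ha [b hb <-]]; exists a => //; try by exists b.
    have [->|a0] := eqVneq a 0; first by right.
    left; case: ha => [[z0 hz]|[t [z0 hz] e]]; [left|right].
      by split=> //; rewrite lt_neqAle z0 eq_sym a0.
    exists t => //; split=> //; rewrite lt_neqAle z0 andbT eq_sym.
    by apply: contraNneq a0 => t0; rewrite -e t0 mulr0 addr0.
  case: ha => [[[z0 hz]|[t [z0 hz] e]]|/= ->].
  - by left; split=> //; apply: ltW.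
  - by right; exists t => //; split=> //; apply: ltW.
  - by left.
rewrite (analyzer_eq Fset_O (Vset_O_unlike hl) sE (Lset_eq HC hl) hK X_N').
by rewrite mulZ0; apply: Q7.
Qed.

Lemma residue_classE m r y : residue_class m r y -> exists t, r = y + m%:Z * t.
Proof.
move=> /dvdzP [q e]; exists (- q); rewrite mulrN mulrC -e; ring.
Qed.

Lemma case_O : Qrange (analyzer C).
Proof.
have [m [hm hl]] := distances_shape HC (or_introl short).
have [m0|m0] := posnP m.
  apply: case_O_zero; first by move=> c; rewrite hm m0.
  case: hl => [|hl|[n [n0 mn _]]]; [by left| by right => c; rewrite hl m0 | by exfalso; lia].
have hK := Kset_eq HC hm.
have Xfull : (forall c d k, dist c d k -> (m %| k)%Z) -> Xset (analyzer C) = setT.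
  move=> dist_m; rewrite Xset_words //; apply/seteqP; split=> // r _.
  have [|y /residue_classE [t ->]] := cross_all HC pairing_O m0 dist_m r.
    by rewrite (hm White) mulZE dvdzz.
  exact: (cross_periodic_m hm).
have unlike c d : d <> c -> d = opp_color c by case: c d => -[].
case: hl => [hl|hl|[n [n0 mn hl]]].
- rewrite (analyzer_eq Fset_O (Vset_O_unlike hl) (Sset_O_unlike hl) (Lset_eq HC hl) hK (Xfull _)).
    exact: Q4.
  move=> c d k; have [->|/eqP /unlike ->] := eqVneq d c; first by rewrite hl.
  by rewrite hm mulZE.
- have dist_m c d k : dist c d k -> (m %| k)%Z.
    by have [->|/eqP /unlike ->] := eqVneq d c; rewrite ?hl ?hm mulZE.
  have hv : forall c, dist c c !=set0 by move=> c; rewrite hl; exists 0; exists 0; rewrite ?mulr0.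
  have [u] : exists u : nat, Sset (analyzer C) = mulZ (u%:Z * (m * 2)%N%:Z).
    apply: Sset_multiple => // w Ww; rewrite PoszM.
    exact: (sigma_even HC pairing_O m0 dist_m).
  have -> : u%:Z * (m * 2)%N%:Z = 2 * u%:Z * m%:Z by rewrite PoszM; ring.
  move=> uE.
  rewrite (analyzer_eq Fset_O (Vset_O_like hv) uE (Lset_eq HC hl) hK (Xfull dist_m)).
  exact: Q1.
- have mE : m%:Z = 2 * n%:Z by rewrite mn PoszM.
  have hm' c : dist c (opp_color c) = mulZ (2 * n%:Z) by rewrite hm mE.
  have Xper := cross_periodic_half hm' hl.
  have dist_n c d k : dist c d k -> (n %| k)%Z.
    have [->|/eqP /unlike ->] := eqVneq d c.
      by rewrite hl => -[t _ <-]; rewrite rpredDr ?dvdzz // dvdz_mulr ?dvdz_mull.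
    by rewrite hm' => -[t _ <-]; rewrite dvdz_mulr ?dvdz_mull.
  have hv : forall c, dist c c !=set0.
    by move=> c; rewrite hl; exists n%:Z; exists 0; rewrite ?mulr0 ?addr0.
  have Xnz r : ~~ (n %| r)%Z -> X r.
    move=> nr; have [|y /residue_classE [t ->]] := cross_nonzero HC pairing_O n0 dist_n _ nr.
      by rewrite hl; exists 0; rewrite ?mulr0 ?addr0.
    exact: Xper.
  have [u uE] := Sset_unlike_multiple hm; move: uE; rewrite mE mulrCA mulrA => uE.
  rewrite mE in hK.
  have [X0|nX0] := pselect (X 0).
    have xE : Xset (analyzer C) = setT.
      rewrite Xset_words //; apply/seteqP; split=> // r _.
      have [/dvdzP [q ->]|/Xnz //] := boolP (n %| r)%Z.
      by rewrite mulrC -[_ * _]add0r; apply: Xper.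
    rewrite (analyzer_eq Fset_O (Vset_O_like hv) uE (Lset_eq HC hl) hK xE).
    exact: Q2.
  have xE : Xset (analyzer C) = setT `\` mulZ n.
    rewrite Xset_words //; apply/seteqP; split=> r.
      move=> Xr; split=> // -[q _ e]; apply: nX0.
      have := Xper _ (- q) Xr; rewrite -e mulrN subrr.
      by [].
    case=> _ /= h; apply: Xnz; apply/negP => /mulZE; exact: h.
  rewrite (analyzer_eq Fset_O (Vset_O_like hv) uE (Lset_eq HC hl) hK xE).
  exact: Q3.
Qed.

End CaseO.

End Cases.

Theorem mainTheorem1 (C : set tcpart) (HC : category C)
    (hC : non_hyperoctahedral C) :
  Qrange (analyzer C).
Proof.
have [Ws|not_s] := pselect (realizable C word_s).
  have [Wf|nf] := pselect (realizable C word_f); first exact: case_S.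
  by apply: case_B => //; apply: short_of_not_f.
apply: case_O => //; apply: short_of_not_f => // Wf.
by case: hC => [/part_sE|]; [exact: not_s | apply; apply/part_fE].
Qed.
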